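(* Let $0<\alpha<Q$, $1\le p<Q/\alpha$ and $1-(\alpha p)/Q\le\kappa<1$. Define $\beta$ by $\beta/Q=\alpha/Q-(1-\kappa)/p$ and assume $\beta<\delta$, where $\delta\in(0,1]$ is the regularity exponent of the kernel of $I_\alpha$ described in the context. Then the fractional integral operator $I_\alpha=(-\Delta_{\mathbb H^n})^{-\alpha/2}$ is bounded from $L^{p,\kappa}(\mathbb H^n)$ into $\mathcal C^\beta(\mathbb H^n)$.
   Context: The Heisenberg group $\mathbb H^n$ is $\mathbb C^n\times\mathbb R$ with multiplication $(z,t)\cdot(z',t')=(z+z',t+t'+2\,\mathrm{Im}(z\cdot\overline{z'}))$, $z\cdot\overline{z'}=\sum_j z_j\overline{z_j'}$; inverse $(z,t)^{-1}=(-z,-t)$; Haar measure is Lebesgue measure, $|E|$ the measure. Homogeneous norm $|(z,t)|=(|z|^4+t^2)^{1/4}$, balls $B(u,r)=\{v:|u^{-1}v|<r\}$, $Q=2n+2$. With $z_j=x_j+iy_j$, $X_j=\partial_{x_j}+2y_j\partial_t$, $Y_j=\partial_{y_j}-2x_j\partial_t$, $\Delta_{\mathbb H^n}=\sum_j(X_j^2+Y_j^2)$. $I_\alpha f=(-\Delta_{\mathbb H^n})^{-\alpha/2}f=\frac1{\Gamma(\alpha/2)}\int_0^\infty e^{s\Delta_{\mathbb H^n}}f\,s^{\alpha/2-1}ds=\int K^*_\alpha(u,v)f(v)\,dv$. The exponent $\delta$: a fixed $\delta\in(0,1]$ such that there is $C>0$ with $|K^*_\alpha(u,w)-K^*_\alpha(v,w)|\le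 C|v^{-1}u|^\delta/|w^{-1}u|^{Q-\alpha+\delta}$ for all $u,v,w$ with $|v^{-1}u|\le|w^{-1}u|/2$. $L^{p,\kappa}(\mathbb H^n)$ is the set of $f\in L^p_{\rm loc}$ with $\|f\|_{L^{p,\kappa}}:=\sup_B\big(|B|^{-\kappa}\int_B|f|^p\big)^{1/p}<\infty$ (supremum over all balls). $\mathcal C^\beta(\mathbb H^n)$ is the set of locally integrable $f$ with $\|f\|_{\mathcal C^\beta}:=\sup_B|B|^{-1-\beta/Q}\int_B|f-f_B|<\infty$, $f_B=|B|^{-1}\int_Bf$.
   Formalization: The bound is stated for (Borel) f in L^{p,κ} whose integral I_α f converges absolutely almost everywhere; this is needed since β≥0 and e.g. f(v)=|v|^{-Q(1-κ)/p} lies in L^{p,κ} but has I_α f identically infinite. *)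

(* Defs.v *)
From HB Require Import structures.
From mathcomp Require Import all_boot all_order all_algebra.
From mathcomp Require Import all_classical all_reals all_analysis.

Set Implicit Arguments.
Unset Strict Implicit.
Unset Printing Implicit Defensive.

Import Order.TTheory GRing.Theory Num.Theory.
Import numFieldNormedType.Exports.
Local Open Scope classical_set_scope.
Local Open Scope ring_scope.

Section Heisenberg.
Variable R : realType.
Variable n : nat.

Local Notation leb := (@lebesgue_measure R).

(* A point of H^n = C^n x R is ((x, y), t) with z_j = x_j + i y_j. *)
Definition Hn : Type := ((n.-tuple R * n.-tuple R) * R)%type.

Definition hx (u : Hn) (j : 'I_n) : R := tnth u.1.1 j.
Definition hy (u : Hn) (j : 'I_n) : R := tnth u.1.2 j.
Definition ht (u : Hn) : R := u.2.

(* (z,t).(z',t') = (z+z', t+t'+2 Im(z . conj z')),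
   Im(z . conj z') = sum_j (y_j x'_j - x_j y'_j) *)
Definition hmul (u v : Hn) : Hn :=
  (([tuple hx u j + hx v j | j < n], [tuple hy u j + hy v j | j < n]),
   ht u + ht v + 2 * \sum_(j < n) (hy u j * hx v j - hx u j * hy v j)).

Definition hinv (u : Hn) : Hn :=
  (([tuple - hx u j | j < n], [tuple - hy u j | j < n]), - ht u).

Definition zsq (u : Hn) : R := \sum_(j < n) (hx u j ^+ 2 + hy u j ^+ 2).

Definition hnorm (u : Hn) : R := powR (zsq u ^+ 2 + ht u ^+ 2) (4%:R^-1).

Definition hQ : R := (2 * n + 2)%:R.

Definition hball (u : Hn) (r : R) : set Hn :=
  [set v | hnorm (hmul (hinv u) v) < r].

(* Lebesgue integral over R^k of a nonnegative function, as an iterated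
   integral (equal to the integral w.r.t. the product Lebesgue measure by
   Tonelli, for measurable nonnegative integrands). *)
Fixpoint iint (k : nat) : (k.-tuple R -> \bar R) -> \bar R :=
  match k return (k.-tuple R -> \bar R) -> \bar R with
  | 0 => fun g => g [tuple]
  | k'.+1 => fun g =>
      (\int[leb]_x iint (fun s : k'.-tuple R => g [tuple of x :: s]))%E
  end.

(* Integral over H^n (Haar = Lebesgue measure) of a nonnegative function *)
Definition hint (g : Hn -> \bar R) : \bar R :=
  iint (fun x => iint (fun y => (\int[leb]_t g ((x, y), t))%E)).

Definition hvol (E : set Hn) : \bar R := hint (fun v => (\1_E v)%:E).

Definition hintS (E : set Hn) (f : Hn -> R) : R :=
  fine (hint (fun v => (\1_E v * Num.max (f v) 0)%:E))
  - fine (hint (fun v => (\1_E v * Num.max (- f v) 0)%:E)).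

Definition havg (E : set Hn) (f : Hn -> R) : R := hintS E f / fine (hvol E).

Definition loc_integrable (f : Hn -> R) : Prop :=
  measurable_fun setT f /\
  forall u r, 0 < r -> (hint (fun v => (\1_(hball u r) v * `|f v|)%:E) < +oo)%E.

Definition morrey_quot (p kappa : R) (f : Hn -> R) (u : Hn) (r : R) : \bar R :=
  (((fine (hvol (hball u r))) `^ (- kappa))%:E *
   hint (fun v => (\1_(hball u r) v * (`|f v| `^ p))%:E)) `^ (p^-1).

Definition morrey_norm (p kappa : R) (f : Hn -> R) : \bar R :=
  ereal_sup [set a | exists u r, 0 < r /\ a = morrey_quot p kappa f u r].

Definition in_morrey (p kappa : R) (f : Hn -> R) : Prop :=
  measurable_fun setT f /\ (morrey_norm p kappa f < +oo)%E.

Definition campanato_quot (beta : R) (f : Hn -> R) (u : Hn) (r : R) : \bar R :=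
  ((fine (hvol (hball u r))) `^ (-1 - beta / hQ))%:E *
  hint (fun v => (\1_(hball u r) v * `|f v - havg (hball u r) f|)%:E).

Definition campanato_norm (beta : R) (f : Hn -> R) : \bar R :=
  ereal_sup [set a | exists u r, 0 < r /\ a = campanato_quot beta f u r].

Definition in_campanato (beta : R) (f : Hn -> R) : Prop :=
  loc_integrable f /\ (campanato_norm beta f < +oo)%E.

Definition Gamma (x : R) : R :=
  Rintegral leb [set s : R | 0 < s] (fun s => s `^ (x - 1) * expR (- s)).

Definition sinhR (x : R) : R := (expR x - expR (- x)) / 2.
Definition cothR (x : R) : R :=
  (expR x + expR (- x)) / (expR x - expR (- x)).

(* Heat kernel of Delta_{H^n} at time s > 0 (Gaveau--Hulanicki formula for
   the present normalization): e^{s Delta} f (u) = int f(v) heat s (v^-1 u) dv,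
   heat s (z,t) = (2 pi)^-1 int_R cos(l t) (l / (pi sinh(4 l s)))^n
                                  exp(- l coth(4 l s) |z|^2) dl. *)
Definition heat (s : R) (w : Hn) : R :=
  (2 * pi)^-1 * Rintegral leb setT (fun l : R =>
     cos (l * ht w) * (l / (pi * sinhR (4 * l * s))) ^+ n *
     expR (- (l * cothR (4 * l * s)) * zsq w)).

(* Kernel of I_alpha = (-Delta)^{-alpha/2}:
   K*_alpha(u,v) = Gamma(alpha/2)^-1 int_0^oo heat s (v^-1 u) s^(alpha/2-1) ds *)
Definition Kalpha (alpha : R) (u v : Hn) : R :=
  (Gamma (alpha / 2))^-1 *
  Rintegral leb [set s : R | 0 < s]
    (fun s => heat s (hmul (hinv v) u) * s `^ (alpha / 2 - 1)).

Definition Ialpha (alpha : R) (f : Hn -> R) (u : Hn) : R :=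
  hintS setT (fun v => Kalpha alpha u v * f v).

End Heisenberg.

(* Main.v *)
(** The kernel of I_alpha is K(u,v) = k(v^-1 u), with k even in t. Chaining the
    regularity estimate along vertical translations (z,t) -> (z,t+s) bounds
    k(w) - L by |w|^(alpha-Q) for |w| <= rho, where L is the value of k at a
    reference point (0,(2 rho)^2). Subtracting a constant from the kernel on a
    ball only changes I_alpha f by a constant, which the Campanato seminorm does
    not see, so neither the homogeneity nor the decay of the heat kernel is
    needed. Given a ball B of radius r, the oscillation of I_alpha f on B is then
    estimated as usual: on the ball of radius 8r by Tonelli and the bound on
    k - L, outside by the regularity estimate and a dyadic summation, which
    converges because beta < delta. The Morrey norm enters through
    int_B |f| <= 2 M |B|^(1-(1-kappa)/p) only. *)

Require Import Defs.
From HB Require Import structures.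
From mathcomp Require Import all_boot all_order all_algebra.
From mathcomp Require Import all_classical all_reals all_analysis.
From mathcomp Require Import measurable_realfun ring lra.
Import Order.TTheory GRing.Theory Num.Theory.
Import numFieldNormedType.Exports.
Local Open Scope classical_set_scope.
Local Open Scope ring_scope.
Set Implicit Arguments.
Unset Strict Implicit.
Unset Printing Implicit Defensive.

(** [hint] is an iterated integral, not an integral against a measure. A sigma-finite measure
    representing it on nonnegative measurable integrands is therefore built before any analysis, and
    measurability is carried along everywhere. Of the explicit heat kernel formula only
    measurability and the dependence on t through a cosine are used.

    The regularity estimate compares k only at points with |v^-1 u| <= |u|/2 and never bounds k
    itself. Vertical chains suit it: for t >= 0 they increase the norm geometrically, and since
    (0,s) is central, (z,t+s) stays at distance |(z,t)| from (0,s), so that all w of norm at most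
    rho reach one common reference point.

    Absolute convergence almost everywhere makes the values of [Ialpha], which are built from
    [fine], genuine integrals; a comparison kernel can then be subtracted under the integral sign
    off a null set. *)

Lemma powRN_le (R : realType) (a b g : R) : 0 <= g -> 0 < a -> a <= b ->
  b `^ (- g) <= a `^ (- g).
Proof.
move=> g0 a0 ab; have b0 : 0 < b by exact: lt_le_trans ab.
rewrite !powRN lef_pV2 ?posrE ?powR_gt0//.
by rewrite ge0_ler_powR ?nnegrE ?(ltW a0) ?(ltW b0).
Qed.

Lemma powR_invN (R : realType) (a e : R) : 0 <= a -> a^-1 `^ (- e) = a `^ e.
Proof. by move=> a0; rewrite -(powR_inv1 a0) -powRrM mulN1r opprK. Qed.

Lemma powR_half_lt1 (R : realType) (e : R) : 0 < e -> 2^-1 `^ e < 1.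
Proof.
move=> e0; have /(_ 2^-1 1) := @gt0_ltr_powR R _ e0.
by rewrite powR1; apply; rewrite ?nnegrE//; lra.
Qed.

Lemma powR_gt1_lt1 (R : realType) (a e : R) : 1 < a -> e < 0 -> a `^ e < 1.
Proof.
move=> a1 e0; have a0 : 0 < a by exact: lt_trans a1.
have ne0 : 0 < - e by rewrite oppr_gt0.
rewrite -[e]opprK powRN invf_lt1 ?powR_gt0//.
have /(_ 1 a) := @gt0_ltr_powR R _ ne0.
by rewrite powR1; apply; rewrite ?nnegrE// ltW.
Qed.

(** * The Heisenberg group *)

Section HeisenbergGroup.
Variables (R : realType) (n : nat).
Local Notation H := (Hn R n).
Implicit Types u v w a b : H.

Definition hone : H := (([tuple 0 | j < n], [tuple 0 | j < n]), 0).

(** The weight 2 on t makes [hnorm] homogeneous of degree one and produces the Jacobian c^(2n+2). *)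
Definition hdil (c : R) v : H :=
  (([tuple c * hx v j | j < n], [tuple c * hy v j | j < n]), c ^+ 2 * ht v).

Lemma hx_mk (F G : 'I_n -> R) t j :
  hx (([tuple F j | j < n], [tuple G j | j < n]), t) j = F j.
Proof. by rewrite /hx/= tnth_mktuple. Qed.

Lemma hy_mk (F G : 'I_n -> R) t j :
  hy (([tuple F j | j < n], [tuple G j | j < n]), t) j = G j.
Proof. by rewrite /hy/= tnth_mktuple. Qed.

Lemma hx_mul u v j : hx (hmul u v) j = hx u j + hx v j.
Proof. exact: hx_mk. Qed.

Lemma hy_mul u v j : hy (hmul u v) j = hy u j + hy v j.
Proof. exact: hy_mk. Qed.

Lemma hx_inv u j : hx (hinv u) j = - hx u j.
Proof. exact: hx_mk. Qed.

Lemma hy_inv u j : hy (hinv u) j = - hy u j.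
Proof. exact: hy_mk. Qed.

Lemma hx_one j : hx hone j = 0. Proof. exact: hx_mk. Qed.

Lemma hy_one j : hy hone j = 0. Proof. exact: hy_mk. Qed.

Lemma hx_dil c u j : hx (hdil c u) j = c * hx u j.
Proof. exact: hx_mk. Qed.

Lemma hy_dil c u j : hy (hdil c u) j = c * hy u j.
Proof. exact: hy_mk. Qed.

Definition hE := (hx_mul, hy_mul, hx_inv, hy_inv, hx_one, hy_one, hx_dil, hy_dil).

Lemma ht_mul u v :
  ht (hmul u v) = ht u + ht v + 2 * \sum_(j < n) (hy u j * hx v j - hx u j * hy v j).
Proof. by []. Qed.

Lemma hn_ext u v :
  (forall j, hx u j = hx v j) -> (forall j, hy u j = hy v j) -> ht u = ht v -> u = v.
Proof.
move: u v => [[x y] t] [[x' y'] t'] hxx hyy /= htt.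
congr (_, _, _) => //; apply: eq_from_tnth; [exact: hxx|exact: hyy].
Qed.

Lemma hmulA u v w : hmul u (hmul v w) = hmul (hmul u v) w.
Proof.
apply: hn_ext => [j|j|]; rewrite ?hE ?addrA// !ht_mul.
set s1 := \sum_(_ < _) _; set s2 := \sum_(_ < _) _.
set s3 := \sum_(_ < _) _; set s4 := \sum_(_ < _) _.
(* By bilinearity of the symplectic form, both bracketings add the same three pairwise terms. *)
suff : s1 + s2 = s3 + s4 by move=> e; lra.
rewrite -!big_split; apply: eq_bigr => j _ /=; rewrite !hE; ring.
Qed.

Lemma hmul1h u : hmul hone u = u.
Proof.
apply: hn_ext => [j|j|]; rewrite ?hE ?add0r// ht_mul big1 ?mulr0 ?addr0 ?add0r//.
by move=> j _; rewrite !hE !mul0r subrr.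
Qed.

Lemma hmulVh u : hmul (hinv u) u = hone.
Proof.
apply: hn_ext => [j|j|]; rewrite ?hE ?addNr// ht_mul big1 ?mulr0 ?addr0 ?addNr//.
by move=> j _; rewrite !hE; ring.
Qed.

Lemma hinvK : involutive (@hinv R n).
Proof. by move=> u; apply: hn_ext => [j|j|]; rewrite ?hE ?opprK//=; rewrite opprK. Qed.

Lemma hmulKh u v : hmul (hinv u) (hmul u v) = v.
Proof. by rewrite hmulA hmulVh hmul1h. Qed.

Lemma hmulKVh u v : hmul u (hmul (hinv u) v) = v.
Proof. by rewrite -{1}[u]hinvK hmulKh. Qed.

Lemma hinv_mulV u v : hinv (hmul (hinv u) v) = hmul (hinv v) u.
Proof.
apply: hn_ext => [j|j|]; rewrite ?hE ?opprD ?opprK 1?addrC//.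
rewrite /= -/(ht u) -/(ht v) !opprD mulrC -mulNr mulrC -[X in _ + 2 * X = _]sumrN.
rewrite opprK addrC [- ht v + _]addrC addrC; congr (_ + 2 * _).
by apply: eq_bigr => j _; rewrite !hE; ring.
Qed.

Lemma zsq_ge0 u : 0 <= zsq u.
Proof. by apply: sumr_ge0 => j _; rewrite addr_ge0 ?sqr_ge0. Qed.

Lemma hnorm_ge0 u : 0 <= hnorm u.
Proof. exact: powR_ge0. Qed.

Lemma hnorm_powR_gt0 u e : 0 < hnorm u -> 0 < hnorm u `^ e.
Proof. exact: powR_gt0. Qed.

Lemma hnorm4 u : hnorm u ^+ 4 = zsq u ^+ 2 + ht u ^+ 2.
Proof.
rewrite -powR_mulrn ?hnorm_ge0// /hnorm -powRrM mulVf ?pnatr_eq0// powRr1//.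
by rewrite addr_ge0 ?sqr_ge0.
Qed.

(** Fourth powers turn comparisons of norms into polynomial inequalities. *)
Lemma hnorm_le u c : 0 <= c -> (hnorm u <= c) = (zsq u ^+ 2 + ht u ^+ 2 <= c ^+ 4).
Proof. by move=> c0; rewrite -hnorm4 ler_pXn2r// nnegrE hnorm_ge0. Qed.

Lemma hnorm_ge u c : 0 <= c -> (c <= hnorm u) = (c ^+ 4 <= zsq u ^+ 2 + ht u ^+ 2).
Proof. by move=> c0; rewrite -hnorm4 ler_pXn2r// nnegrE hnorm_ge0. Qed.

Lemma hnorm_eq u v :
  zsq u ^+ 2 + ht u ^+ 2 = zsq v ^+ 2 + ht v ^+ 2 -> hnorm u = hnorm v.
Proof. by rewrite /hnorm => ->. Qed.

Lemma zsq_inv u : zsq (hinv u) = zsq u.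
Proof. by apply: eq_bigr => j _; rewrite !hE !sqrrN. Qed.

Lemma hnorm_inv u : hnorm (hinv u) = hnorm u.
Proof. by apply: hnorm_eq; rewrite zsq_inv /= sqrrN. Qed.

Lemma hnormVC u v : hnorm (hmul (hinv u) v) = hnorm (hmul (hinv v) u).
Proof. by rewrite -hinv_mulV hnorm_inv. Qed.

Lemma zsq_one : zsq hone = 0.
Proof. by rewrite /zsq big1// => j _; rewrite !hE expr0n addr0. Qed.

Lemma zsq_dil c u : zsq (hdil c u) = c ^+ 2 * zsq u.
Proof. by rewrite /zsq mulr_sumr; apply: eq_bigr => j _; rewrite !hE; ring. Qed.

Lemma hnorm_dil c u : 0 <= c -> hnorm (hdil c u) = c * hnorm u.
Proof.
move=> c0; apply/eqP; rewrite -(@eqrXn2 _ 4) ?mulr_ge0 ?hnorm_ge0//.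
by rewrite exprMn !hnorm4 zsq_dil /= -/(ht u); apply/eqP; ring.
Qed.

(** Minkowski's inequality in the plane, squared so that no root appears; the scalar product is
    bounded through Lagrange's identity. *)
Lemma sqr_add_le (x y x' y' r r' : R) : 0 <= r -> 0 <= r' ->
  x ^+ 2 + y ^+ 2 <= r ^+ 2 -> x' ^+ 2 + y' ^+ 2 <= r' ^+ 2 ->
  (x + x') ^+ 2 + (y + y') ^+ 2 <= (r + r') ^+ 2.
Proof.
move=> r0 r'0 h h'.
have : x * x' + y * y' <= r * r'.
  apply: (le_trans (ler_norm _)); rewrite -(@ler_pXn2r _ 2)// ?nnegrE ?mulr_ge0//.
  rewrite real_normK ?num_real//.
  apply: (@le_trans _ _ ((x ^+ 2 + y ^+ 2) * (x' ^+ 2 + y' ^+ 2))).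
    rewrite -subr_ge0.
    have -> : (x ^+ 2 + y ^+ 2) * (x' ^+ 2 + y' ^+ 2) - (x * x' + y * y') ^+ 2
      = (x * y' - y * x') ^+ 2 by ring.
    exact: sqr_ge0.
  by rewrite exprMn ler_pM// addr_ge0 ?sqr_ge0.
by move=> hc; nra.
Qed.

(* The Hermitian Cauchy-Schwarz inequality |z . conj z'|^2 <= |z|^2 |z'|^2,
   read off the sum over j of | |z'|^2 z_j - (z . conj z') z'_j |^2. *)
Lemma hermitian_cs u v :
  (\sum_(j < n) (hx u j * hx v j + hy u j * hy v j)) ^+ 2 +
  (\sum_(j < n) (hy u j * hx v j - hx u j * hy v j)) ^+ 2 <= zsq u * zsq v.
Proof.
set a := \sum_(_ < _) _; set b := \sum_(_ < _) _.
have S : 0 <= zsq v * (zsq u * zsq v - (a ^+ 2 + b ^+ 2)).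
  have -> : zsq v * (zsq u * zsq v - (a ^+ 2 + b ^+ 2)) =
    \sum_(j < n) ((zsq v * hx u j - (a * hx v j - b * hy v j)) ^+ 2 +
                  (zsq v * hy u j - (a * hy v j + b * hx v j)) ^+ 2).
    rewrite (eq_bigr (fun j => zsq v ^+ 2 * (hx u j ^+ 2 + hy u j ^+ 2)
      + (- 2 * zsq v * a) * (hx u j * hx v j + hy u j * hy v j)
      + (- 2 * zsq v * b) * (hy u j * hx v j - hx u j * hy v j)
      + (a ^+ 2 + b ^+ 2) * (hx v j ^+ 2 + hy v j ^+ 2))); last by move=> j _; ring.
    by rewrite !big_split/= -!mulr_sumr -/(zsq u) -/(zsq v) -/a -/b; ring.
  by apply: sumr_ge0 => j _; rewrite addr_ge0 ?sqr_ge0.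
have [v0|v0] := eqVneq (zsq v) 0; last first.
  by move: S; rewrite pmulr_rge0 ?subr_ge0// lt_def v0 zsq_ge0.
have hv j : hx v j = 0 /\ hy v j = 0.
  have /eqP := v0; rewrite psumr_eq0; last by move=> k _; rewrite addr_ge0 ?sqr_ge0.
  move=> /allP /(_ j); rewrite mem_index_enum => /(_ isT) /=.
  by rewrite paddr_eq0 ?sqr_ge0// !sqrf_eq0 => /andP[/eqP -> /eqP ->].
rewrite /a /b big1 ?big1 ?v0 ?mulr0 ?expr0n ?addr0// => j _;
  by have [-> ->] := hv j; rewrite !mulr0 ?addr0 ?subrr.
Qed.

(* With |(z,t)|^2 = | |z|^2 + i t |, the value |z|^2 + i t at a product uv is
   the sum of those at u and v plus 2 z . conj z'. *)
Lemma hnorm_triangle u v : hnorm (hmul u v) <= hnorm u + hnorm v.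
Proof.
rewrite hnorm_le ?addr_ge0 ?hnorm_ge0// ht_mul.
set b := \sum_(_ < _) _.
pose a := \sum_(j < n) (hx u j * hx v j + hy u j * hy v j).
have -> : zsq (hmul u v) = zsq u + zsq v + 2 * a.
  rewrite /zsq /a mulr_sumr -!big_split; apply: eq_bigr => j _ /=.
  by rewrite !hE; ring.
have cs : (2 * a) ^+ 2 + (2 * b) ^+ 2 <= (2 * (hnorm u * hnorm v)) ^+ 2.
  have := hermitian_cs u v; rewrite -/a -/b => cs.
  have hz w : zsq w <= hnorm w ^+ 2.
    rewrite -(@ler_pXn2r _ 2)// ?nnegrE ?sqr_ge0 ?zsq_ge0// -exprM hnorm4.
    by rewrite lerDl sqr_ge0.
  have : zsq u * zsq v <= hnorm u ^+ 2 * hnorm v ^+ 2.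
    by rewrite ler_pM ?zsq_ge0 ?hz.
  by move=> hc; nra.
(* Three planar vectors are added, of lengths at most |u|^2, |v|^2 and 2 |u| |v|. *)
have -> : (hnorm u + hnorm v) ^+ 4 =
  (hnorm u ^+ 2 + hnorm v ^+ 2 + 2 * (hnorm u * hnorm v)) ^+ 2 by ring.
have nu2 w : zsq w ^+ 2 + ht w ^+ 2 <= (hnorm w ^+ 2) ^+ 2 by rewrite -exprM hnorm4.
apply: sqr_add_le cs; rewrite ?addr_ge0 ?sqr_ge0 ?mulr_ge0 ?hnorm_ge0//.
by apply: sqr_add_le; rewrite ?sqr_ge0.
Qed.

Lemma hdist_triangle u v w :
  hnorm (hmul (hinv u) w) <= hnorm (hmul (hinv u) v) + hnorm (hmul (hinv v) w).
Proof. by rewrite -{1}[w](hmulKVh v) hmulA; exact: hnorm_triangle. Qed.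

End HeisenbergGroup.

(** * Iterated Lebesgue integrals *)

(** Both exhausting sequences are increasing, so the diagonal rectangles already cover the
    product. *)
Lemma sigma_finite_product d1 d2 (T1 : measurableType d1) (T2 : measurableType d2)
  (R : realType) (m1 : {sigma_finite_measure set T1 -> \bar R})
  (m2 : {sigma_finite_measure set T2 -> \bar R}) : sigma_finite setT (m1 \x m2)%E.
Proof.
have /sigma_finiteP[F [FT ndF Foo]] := sigma_finiteT m1.
have /sigma_finiteP[G [GT ndG Goo]] := sigma_finiteT m2.
exists (fun n => F n `*` G n).
  rewrite -setXTT FT GT predeqE => -[x y]; split => [[/= [i _ Fx] [j _ Gy]]|].
    exists (maxn i j) => //; split.
    - by move: x Fx; exact/subsetPset/ndF/leq_maxl.
    - by move: y Gy; exact/subsetPset/ndG/leq_maxr.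
  by move=> [i _ []/= ? ?]; split; exists i.
move=> i; have [mF Fi] := Foo i; have [mG Gi] := Goo i.
by split; [exact: measurableX|rewrite product_measure1E// lte_mul_pinfty// ge0_fin_numE].
Qed.

Section LebesgueTuples.
Variable R : realType.
Local Notation leb := (@lebesgue_measure R).
Local Open Scope ereal_scope.

(** The pushforward of Lebesgue measure under x -> a + c x, multiplied by c, agrees with Lebesgue
    measure on half-open intervals, hence everywhere by uniqueness. *)
Lemma ge0_integral_affine (c a : R) (f : R -> \bar R) : (0 < c)%R ->
  measurable_fun setT f -> (forall x, 0 <= f x) ->
  \int[leb]_x f (a + c * x)%R = c^-1%:E * \int[leb]_x f x.
Proof.
move=> c0 mf f0.
pose phi : measurableTypeR R -> measurableTypeR R := fun x => (a + c * x)%R.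
have mphi : measurable_fun setT phi.
  by apply: measurable_funD => //; exact: measurable_funM.
pose pf : {measure set (measurableTypeR R) -> \bar R} :=
  ltac:(refine (pushforward leb phi); exact: mphi).
pose m' := mscale (NngNum (ltW c0)) pf.
have E A : measurable A -> leb A = m' A.
  apply: lebesgue_measure_unique => _ [[u v] /= _ <-].
  rewrite /m' /mscale/= /pushforward.
  have -> : phi @^-1` `]u, v]%classic = `]((u - a) / c)%R, ((v - a) / c)%R]%classic.
    apply/seteqP; split=> x /=; rewrite !in_itv/= /phi ltr_pdivrMr// ler_pdivlMr//;
      by rewrite (mulrC x) ltrBlDl lerBrDl.
  rewrite lebesgue_measure_itv /= lebesgue_measure_itv /= !lte_fin.
  rewrite ltr_pM2r ?invr_gt0// ltrD2r.
  case: ifPn => _; last by rewrite mule0.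
  rewrite -!EFinD -EFinM; congr EFin; field.
  by rewrite gt_eqF.
have -> : \int[leb]_x f x = c%:E * \int[leb]_x f (a + c * x)%R.
  rewrite (eq_measure_integral m'); last first.
    by move=> A mA _; first [exact: E | exact: (esym (E _ mA))].
  rewrite ge0_integral_mscale//=; congr (_ * _).
  exact: (ge0_integral_pushforward mphi leb measurableT mf (fun y _ => f0 y)).
by rewrite muleA -EFinM mulVf ?gt_eqF// mul1e.
Qed.

Lemma measurable_tuple_cons k :
  measurable_fun setT (fun p : R * k.-tuple R => [tuple of p.1 :: p.2]).
Proof. exact: measurable_cons. Qed.

(** Prepending a coordinate pushes the product of Lebesgue measure and the measure for k forward to
    tuples of length k+1, and Tonelli unfolds the new integral into the iterated one. *)
Lemma iint_measure k : exists m : {sigma_finite_measure set (k.-tuple R) -> \bar R},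
  forall g : k.-tuple R -> \bar R, measurable_fun setT g -> (forall x, 0 <= g x) ->
  iint g = \int[m]_x g x.
Proof.
elim: k => [|k [m mE]].
  exists (\d_ [tuple]) => g mg g0 /=.
  by rewrite integral_dirac// diracT mul1e.
pose phi (p : measurableTypeR R * k.-tuple R) : k.+1.-tuple R := [tuple of p.1 :: p.2].
have mphi : measurable_fun setT phi by exact: measurable_tuple_cons.
pose psi := fun s : k.+1.-tuple R => (thead s, [tuple of behead s]).
have mpsi : measurable_fun setT psi.
  apply/measurable_fun_pairP; split; first exact: measurable_tnth.
  exact: measurable_behead.
have psiK : cancel phi psi.
  by move=> [x s]; rewrite /psi /phi theadE; congr pair; apply: val_inj.
pose m' : {measure set (k.+1.-tuple R) -> \bar R} :=
  ltac:(refine (pushforward (leb \x m) phi); exact: mphi).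
(* A pushforward may lose sigma-finiteness; here the inverse map [psi] carries the exhausting sets
   over. *)
have sf : sigma_finite setT m'.
  have [F FT Foo] := @sigma_finite_product _ _ _ _ _ leb m.
  exists (fun i => psi @^-1` F i).
    by rewrite -preimage_bigcup -FT preimage_setT.
  move=> i; have [mF Fi] := Foo i; split.
    by rewrite -[_ @^-1` _]setTI; exact: mpsi.
  rewrite /m' /= /pushforward (_ : _ @^-1` _ = F i)//.
  by apply/seteqP; split=> p; rewrite /preimage/= -/(phi p) psiK.
pose sfm := Measure_isSigmaFinite.Build _ _ _ m' sf.
pose m1 : {sigma_finite_measure set (k.+1.-tuple R) -> \bar R} :=
  HB.pack (Measure.sort m') sfm.
exists m1 => g mg g0 /=.
have mgphi : measurable_fun setT (g \o phi) by exact: measurableT_comp.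
rewrite [RHS](@ge0_integral_pushforward _ _ _ _ _ phi)//=.
rewrite fubini_tonelli1//=.
apply: eq_integral => x _; rewrite mE//.
exact: (measurableT_comp mgphi (pair1_measurable x)).
Qed.

Lemma iintZ k (c : R) (g : k.-tuple R -> \bar R) : (0 <= c)%R ->
  measurable_fun setT g -> (forall x, 0 <= g x) ->
  iint (fun s => c%:E * g s) = c%:E * iint g.
Proof.
move=> c0 mg g0; have [m mE] := iint_measure k.
rewrite !mE// ?ge0_integralZl//; last by move=> x; rewrite mule_ge0.
exact: measurable_funeM.
Qed.

Lemma measurable_iint d (T : measurableType d) k (g : T * k.-tuple R -> \bar R) :
  measurable_fun setT g -> (forall x, 0 <= g x) ->
  measurable_fun setT (fun x => iint (fun s => g (x, s))).
Proof.
move=> mg g0; have [m mE] := iint_measure k.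
rewrite [X in measurable_fun _ X](_ : _ = fubini_F m g).
  exact: measurable_fun_fubini_tonelli_F.
apply/funext => x; rewrite mE//; exact: (measurableT_comp mg (pair1_measurable x)).
Qed.

Lemma iint_ge0 k (g : k.-tuple R -> \bar R) : (forall x, 0 <= g x) -> 0 <= iint g.
Proof.
elim: k g => [|k IH] g g0 /=; first exact: g0.
apply: integral_ge0 => x _; exact: IH.
Qed.

Lemma measurable_tuple_affine k (c : R) (a : 'I_k -> R) :
  measurable_fun setT (fun s : k.-tuple R => [tuple (a j + c * tnth s j)%R | j < k]).
Proof.
apply/measurable_fun_tnthP => i.
rewrite (_ : _ \o _ = fun s => a i + c * tnth s i)%R; last first.
  by apply/funext => s; rewrite /= tnth_mktuple.
apply: measurable_funD => //; apply: measurable_funM => //.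
exact: measurable_tnth.
Qed.

(** Each coordinate contributes one factor c^-1. The shift may vary with the coordinate, as it does
    for a left translation. *)
Lemma iint_affine k (c : R) (a : 'I_k -> R) (g : k.-tuple R -> \bar R) : (0 < c)%R ->
  measurable_fun setT g -> (forall x, 0 <= g x) ->
  iint (fun s => g [tuple (a j + c * tnth s j)%R | j < k]) = (c^-1 ^+ k)%:E * iint g.
Proof.
move=> c0; elim: k a g => [|k IH] a g mg g0 /=.
  rewrite expr0 mul1e; by rewrite [X in g X]tuple0.
have mgx x : measurable_fun setT (fun s : k.-tuple R => g [tuple of x :: s]).
  exact: (measurableT_comp (measurableT_comp mg (@measurable_tuple_cons k))
    (pair1_measurable x)).
pose h x := iint (fun s => g [tuple of x :: s]).
have h0 x : 0 <= h x by exact: iint_ge0.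
have mh : measurable_fun setT h.
  apply: (@measurable_iint _ _ _ (fun p : measurableTypeR R * k.-tuple R =>
    g [tuple of p.1 :: p.2])) => //.
  exact: (measurableT_comp mg (@measurable_tuple_cons k)).
transitivity (\int[leb]_x ((c^-1 ^+ k)%:E * h (a ord0 + c * x)%R)).
  apply: eq_integral => x _; rewrite -(IH (fun j => a (lift ord0 j)))//.
  congr iint.
  apply/funext => s; congr g; apply: eq_from_tnth => i.
  rewrite tnth_mktuple; have [j ->|->] := unliftP ord0 i; last by rewrite !tnth0.
  by rewrite !tnthS tnth_mktuple.
rewrite ge0_integralZl//; last 2 first.
- apply: (measurableT_comp mh); apply: measurable_funD => //; exact: measurable_funM.
- by rewrite lee_fin exprn_ge0// invr_ge0 ltW.
by rewrite ge0_integral_affine// muleA -EFinM -exprSr.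
Qed.

Lemma iint_prod k (h : R -> R) (b : R) : measurable_fun setT h ->
  (forall x, 0 <= h x)%R -> \int[leb]_x (h x)%:E = b%:E ->
  iint (fun s : k.-tuple R => (\prod_(j < k) h (tnth s j))%:E) = (b ^+ k)%:E.
Proof.
move=> mh h0 hb; elim: k => [|k IH] /=; first by rewrite big_ord0 expr0.
have b0 : (0 <= b)%R by rewrite -lee_fin -hb integral_ge0// => x _; rewrite lee_fin.
transitivity (\int[leb]_x ((b ^+ k)%:E * (h x)%:E)).
  apply: eq_integral => x _; rewrite muleC -IH -iintZ//.
  - congr iint; apply/funext => s; rewrite -EFinM big_ord_recl; congr (_ * _)%:E.
    by apply: eq_bigr => j _; rewrite tnthS.
  - apply/measurable_EFinP.
    apply: (@measurable_prod _ _ _ _ _ _ (fun j (s : k.-tuple R) => h (tnth s j))) => j _.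
    exact: (measurableT_comp mh (@measurable_tnth _ _ _ _)).
  - by move=> s; rewrite lee_fin prodr_ge0.
rewrite ge0_integralZl//; last by rewrite lee_fin exprn_ge0.
- by rewrite hb -EFinM -exprSr.
- exact/measurable_EFinP.
- by move=> x _; rewrite lee_fin.
Qed.

End LebesgueTuples.

(** * Haar measure *)

Section HaarMeasure.
Variables (R : realType) (n : nat).
Local Notation H := (Hn R n).
Local Notation leb := (@lebesgue_measure R).
Implicit Types (u v w a : H) (g : H -> \bar R).

Lemma measurable_hx j : measurable_fun setT (fun v : H => hx v j).
Proof.
apply: (measurableT_comp (@measurable_tnth _ R n j)).
exact: (measurableT_comp measurable_fst measurable_fst).
Qed.

Lemma measurable_hy j : measurable_fun setT (fun v : H => hy v j).
Proof.
apply: (measurableT_comp (@measurable_tnth _ R n j)).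
exact: (measurableT_comp measurable_snd measurable_fst).
Qed.

Lemma measurable_ht : measurable_fun setT (fun v : H => ht v).
Proof. exact: measurable_snd. Qed.

Lemma measurable_mkhn d (T : measurableType d) (F G : T -> 'I_n -> R) (t : T -> R) :
  (forall j, measurable_fun setT (F ^~ j)) -> (forall j, measurable_fun setT (G ^~ j)) ->
  measurable_fun setT t ->
  measurable_fun setT (fun x => (([tuple F x j | j < n], [tuple G x j | j < n]), t x) : H).
Proof.
move=> mF mG mt; apply/measurable_fun_pairP; split=> //.
apply/measurable_fun_pairP; split; apply/measurable_fun_tnthP => j.
  rewrite (_ : _ \o _ = F ^~ j)//.
  by apply/funext => x; rewrite /= tnth_mktuple.
rewrite (_ : _ \o _ = G ^~ j)//.
by apply/funext => x; rewrite /= tnth_mktuple.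
Qed.

Lemma measurable_hmul d (T : measurableType d) (f h : T -> H) :
  measurable_fun setT f -> measurable_fun setT h ->
  measurable_fun setT (fun x => hmul (f x) (h x)).
Proof.
move=> mf mh; have [mx my] := (measurable_hx, measurable_hy).
apply: (@measurable_mkhn _ _ (fun x j => hx (f x) j + hx (h x) j)
  (fun x j => hy (f x) j + hy (h x) j)) => [j|j|].
- by apply: measurable_funD;
    [exact: (measurableT_comp (mx j) mf)|exact: (measurableT_comp (mx j) mh)].
- by apply: measurable_funD;
    [exact: (measurableT_comp (my j) mf)|exact: (measurableT_comp (my j) mh)].
- apply: measurable_funD.
    by apply: measurable_funD;
      [exact: (measurableT_comp measurable_ht mf)|exact: (measurableT_comp measurable_ht mh)].
  apply: measurable_funM => //; apply: measurable_sum => j.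
  apply: measurable_funB; apply: measurable_funM;
    [exact: (measurableT_comp (my j) mf)|exact: (measurableT_comp (mx j) mh)|
     exact: (measurableT_comp (mx j) mf)|exact: (measurableT_comp (my j) mh)].
Qed.

Lemma measurable_hinv d (T : measurableType d) (f : T -> H) :
  measurable_fun setT f -> measurable_fun setT (fun x => hinv (f x)).
Proof.
move=> mf; apply: (@measurable_mkhn _ _ (fun x j => - hx (f x) j)
  (fun x j => - hy (f x) j)) => [j|j|]; apply: measurable_funN.
- exact: (measurableT_comp (measurable_hx j) mf).
- exact: (measurableT_comp (measurable_hy j) mf).
- exact: (measurableT_comp measurable_ht mf).
Qed.

Lemma measurable_zsq : measurable_fun setT (fun v : H => zsq v).
Proof.
apply: measurable_sum => j; apply: measurable_funD; apply: measurable_funX.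
  exact: measurable_hx.
exact: measurable_hy.
Qed.

Lemma measurable_hnorm d (T : measurableType d) (f : T -> H) :
  measurable_fun setT f -> measurable_fun setT (fun x => hnorm (f x)).
Proof.
move=> mf; apply: (@measurableT_comp _ _ _ _ _ _ (fun v : H => hnorm v)) => //.
apply: (measurableT_comp (measurable_powR _)).
apply: measurable_funD; apply: measurable_funX; first exact: measurable_zsq.
exact: measurable_ht.
Qed.

Local Open Scope ereal_scope.

(* The two measurable structures on R, [measurableTypeR R] and [R] itself, have the
   same measurable sets but different displays. *)
Lemma lebesgue_measure_realType : exists l : {sigma_finite_measure set R -> \bar R},
  forall f : R -> \bar R, measurable_fun setT f -> (forall x, 0 <= f x) ->
  \int[leb]_x f x = \int[l]_x f x.
Proof.
pose phi : measurableTypeR R -> R := id.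
have mphi : measurable_fun setT phi by move=> _ A mA; rewrite setTI.
pose l : {measure set R -> \bar R} := ltac:(refine (pushforward leb phi); exact: mphi).
have sf : sigma_finite setT l.
  have [F FT Foo] := sigma_finiteT leb.
  by exists F => // i; have [mF Fi] := Foo i.
pose l' : {sigma_finite_measure set R -> \bar R} :=
  HB.pack (Measure.sort l) (Measure_isSigmaFinite.Build _ _ _ l sf).
exists l' => f mf f0.
exact: (esym (ge0_integral_pushforward mphi leb measurableT mf (fun y _ => f0 y))).
Qed.

(** Gives access to monotone limits, almost-everywhere comparison and exchange of integrals on the
    group; Tonelli limits the identity to nonnegative measurable integrands. *)
Lemma hint_measure : exists mu : {sigma_finite_measure set H -> \bar R},
  forall g, measurable_fun setT g -> (forall v, 0 <= g v) -> hint g = \int[mu]_v g v.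
Proof.
have [m mE] := iint_measure R n; have [l lE] := lebesgue_measure_realType.
pose mm : {sigma_finite_measure set (n.-tuple R * n.-tuple R)%type -> \bar R} :=
  HB.pack (m \x m)%E (Measure_isSigmaFinite.Build _ _ _ (m \x m)%E
    (@sigma_finite_product _ _ _ _ _ m m)).
pose mu : {sigma_finite_measure set (n.-tuple R * n.-tuple R * R)%type
    -> \bar R} :=
  HB.pack (mm \x l)%E (Measure_isSigmaFinite.Build _ _ _ (mm \x l)%E
    (@sigma_finite_product _ _ _ _ _ mm l)).
exists mu => g mg g0.
have mF : measurable_fun setT (fun p : n.-tuple R * n.-tuple R => \int[leb]_t g (p, t)).
  exact: (@measurable_fun_fubini_tonelli_F _ _ _ _ _ leb g).
have F0 p : 0 <= \int[leb]_t g (p, t) by apply: integral_ge0.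
rewrite [RHS](@fubini_tonelli1 _ _ _ _ _ mm l g)//.
rewrite (_ : fubini_F _ _ = fun p => \int[leb]_t g (p, t)); last first.
  by apply/funext => p; rewrite lE//; exact: (measurableT_comp mg (pair1_measurable p)).
rewrite [RHS](@fubini_tonelli1 _ _ _ _ _ m m)//.
rewrite /hint mE; last by move=> x; exact: iint_ge0.
  apply: eq_integral => x _; rewrite mE//.
  exact: (measurableT_comp mF (pair1_measurable x)).
exact: (@measurable_iint _ _ _ _ (fun p => \int[leb]_t g (p, t))).
Qed.

(** For fixed (x,y) the symplectic twist only shifts t, so integrating in t first absorbs it and
    leaves c^-2; the 2n horizontal coordinates give c^-1 each. *)
Lemma hint_affine (c : R) a g : (0 < c)%R -> measurable_fun setT g -> (forall v, 0 <= g v) ->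
  hint (fun v => g (hmul a (hdil c v))) = (c^-1 ^+ (2 * n + 2))%:E * hint g.
Proof.
move=> c0 mg g0.
have ci0 k : (0 <= c^-1 ^+ k)%R by rewrite exprn_ge0// invr_ge0 ltW.
pose F (p : n.-tuple R * n.-tuple R) := \int[leb]_t g (p, t).
have mF : measurable_fun setT F by exact: (@measurable_fun_fubini_tonelli_F _ _ _ _ _ leb g).
have F0 p : 0 <= F p by exact: integral_ge0.
have mFx x : measurable_fun setT (fun y => F (x, y)).
  exact: (measurableT_comp mF (pair1_measurable x)).
pose G x := iint (fun y => F (x, y)).
have mG : measurable_fun setT G by exact: measurable_iint.
have G0 x : 0 <= G x by exact: iint_ge0.
pose A (b : 'I_n -> R) (s : n.-tuple R) := [tuple (b j + c * tnth s j)%R | j < n].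
have mA b : measurable_fun setT (A b) by exact: measurable_tuple_affine.
transitivity (iint (fun x => (c^-1 ^+ (n + 2))%:E * G (A (hx a) x))).
  congr iint; apply/funext => x.
  transitivity (iint (fun y => (c^-1 ^+ 2)%:E * F (A (hx a) x, A (hy a) y))).
    congr iint; apply/funext => y.
    pose p := (A (hx a) x, A (hy a) y).
    pose b := (ht a + 2 * \sum_(j < n) (hy a j * (c * tnth x j) - hx a j * (c * tnth y j)))%R.
    transitivity (\int[leb]_t g (p, b + c ^+ 2 * t)%R).
      apply: eq_integral => t _; congr g; apply: hn_ext => [j|j|].
      - by rewrite !hE /p /A /hx /= !tnth_mktuple.
      - by rewrite !hE /p /A /hy /= !tnth_mktuple.
      - rewrite ht_mul /b /= addrAC; congr (_ + _ * _ + _)%R.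
        by apply: eq_bigr => j _; rewrite !hE.
    rewrite (@ge0_integral_affine _ _ _ (fun t => g (p, t))) ?exprn_gt0//.
      by rewrite exprVn.
    exact: (measurableT_comp mg (pair1_measurable p)).
  rewrite iintZ//; last exact: (measurableT_comp (mFx _)).
  rewrite (@iint_affine _ _ _ _ (fun y => F (A (hx a) x, y)))//.
  by rewrite muleA -EFinM -exprD addnC.
rewrite iintZ//; last exact: measurableT_comp.
rewrite iint_affine// muleA -EFinM -exprD; congr ((_ ^+ _)%:E * _).
by rewrite addnAC addnn mul2n.
Qed.

Local Notation I11 := (`[(-1)%R, 1%R]%classic : set R).

(** The box [-1,1]^(2n+1) has a volume that factorizes; ball volumes are compared with it. *)
Lemma hint_cube :
  hint (fun v : H => ((\prod_(j < n) \1_I11 (hx v j)) *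
    (\prod_(j < n) \1_I11 (hy v j)) * \1_I11 (ht v))%R%:E)
  = (2 ^+ (2 * n + 1))%:E.
Proof.
pose h : R -> R := \1_I11.
have mh : measurable_fun setT h by exact: measurable_indic.
have h0 x : (0 <= h x)%R by [].
have hb : \int[leb]_x (h x)%:E = 2%:E.
  have -> : \int[leb]_x (h x)%:E = leb I11 by rewrite integral_indic// setIT.
  rewrite lebesgue_measure_itv/= lte_fin ifT; last by lra.
  by rewrite -EFinB; congr EFin; lra.
pose P (s : n.-tuple R) := (\prod_(j < n) h (tnth s j))%R.
have P0 s : (0 <= P s)%R by exact: prodr_ge0.
have mP : measurable_fun setT (EFin \o P).
  apply/measurable_EFinP.
  apply: (@measurable_prod _ _ _ _ _ _ (fun j (s : n.-tuple R) => h (tnth s j))) => j _.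
  exact: (measurableT_comp mh (@measurable_tnth _ _ _ _)).
transitivity (iint (fun x => (2 ^+ (n + 1))%:E * (P x)%:E)).
  congr iint; apply/funext => x.
  transitivity (iint (fun y => (2 * P x)%:E * (P y)%:E)).
    congr iint; apply/funext => y.
    transitivity (\int[leb]_t ((P x * P y)%:E * (h t)%:E)).
      by apply: eq_integral => t _; rewrite -EFinM.
    rewrite ge0_integralZl//; last 2 first.
    - by move=> t _; rewrite lee_fin.
    - by rewrite lee_fin mulr_ge0.
    - by rewrite hb -!EFinM; congr EFin; ring.
    - exact/measurable_EFinP.
  rewrite (@iintZ _ _ (2 * P x)%R (EFin \o P)) ?mulr_ge0//.
  by rewrite /P (iint_prod _ mh h0 hb) -!EFinM addn1 exprS; congr EFin; ring.
rewrite (@iintZ _ _ _ (EFin \o P))// /P (iint_prod _ mh h0 hb) -EFinM -exprD.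
by rewrite addnAC addnn mul2n.
Qed.

End HaarMeasure.

(** * Dyadic decomposition *)

Section Dyadic.
Variable R : realType.

Lemma geometric_sum_le (x : R) m : 0 <= x -> x < 1 ->
  \sum_(0 <= j < m) x ^+ j <= (1 - x)^-1.
Proof.
move=> x0 x1; have x10 : 0 < 1 - x by rewrite subr_gt0.
have E : (1 - x) * (\sum_(0 <= j < m) x ^+ j) = 1 - x ^+ m.
  elim: m => [|m IH]; first by rewrite big_geq// mulr0 expr0 subrr.
  by rewrite big_nat_recr//= mulrDr IH exprS; ring.
by rewrite -[leRHS]mulr1 ler_pdivlMl// E gerBl exprn_ge0.
Qed.

Lemma exp2_bracket (x : R) : 1 <= x -> exists j : nat, 2 ^+ j <= x /\ x < 2 ^+ j.+1.
Proof.
move=> x1; have ex : exists j : nat, x < 2 ^+ j.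
  exists (Num.truncn x).+1.
  apply: (lt_le_trans (Num.Theory.truncnS_gt x)).
  by rewrite -natrX ler_nat ltnW// ltn_expl.
case: (ex_minnP ex) => -[|j] xj jmin; first by move: xj; rewrite expr0 ltNge x1.
exists j; split=> //; rewrite leNgt; apply/negP => /jmin.
by rewrite ltnn.
Qed.

Local Open Scope ereal_scope.

(** One summation serves two regimes: q = 2 for shells going out to infinity, q = 1/2 for shells
    shrinking to the centre. In both, the condition on q^(s - g) makes the contributions geometric.
    The shells have outer to inner ratio 4 and overlap, which leaves room for either way of locating
    a point between powers of 2. *)
Lemma dyadic_integral_le d (T : measurableType d) (mu : {measure set T -> \bar R})
  (N phi h : T -> R) (D s g q rho : R) :
  measurable_fun setT N -> measurable_fun setT phi -> measurable_fun setT h ->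
  (forall v, 0 <= phi v)%R -> (forall v, 0 <= h v)%R -> (0 <= D)%R ->
  (forall tau, (0 < tau)%R ->
    \int[mu]_v (\1_[set v | (N v < tau)%R] v * phi v)%:E <= (D * tau `^ s)%:E) ->
  (0 <= g)%R -> (0 < rho)%R -> (0 < q)%R -> (q `^ (s - g) < 1)%R ->
  (forall v, h v = 0%R \/ exists j : nat, [/\ (rho / 2 * q ^+ j <= N v)%R,
    (N v < 2 * rho * q ^+ j)%R & (h v <= N v `^ (- g))%R]) ->
  \int[mu]_v (h v * phi v)%:E <=
    (D * 2 `^ (g + s) / (1 - q `^ (s - g)) * rho `^ (s - g))%:E.
Proof.
move=> mN mphi mh phi0 h0 D0 HD g0 rho0 q0 x1 Hh.
set x := (q `^ (s - g))%R.
have x0 : (0 <= x)%R by exact: powR_ge0.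
pose a j := ((rho / 2 * q ^+ j) `^ (- g))%R.
pose b j := (2 * rho * q ^+ j)%R.
have b0 j : (0 < b j)%R by rewrite !mulr_gt0// exprn_gt0.
have a0 j : (0 <= a j)%R by exact: powR_ge0.
pose F j v := (a j)%:E * (\1_[set v | (N v < b j)%R] v * phi v)%:E.
have mI j : measurable_fun setT (fun v => (\1_[set v | (N v < b j)%R] v * phi v)%:E).
  apply/measurable_EFinP; apply: measurable_funM => //; apply: measurable_indic.
  by rewrite -[X in measurable X]setTI; apply: measurable_fun_ltr.
have I0 j v : 0 <= (\1_[set v | (N v < b j)%R] v * phi v)%:E.
  by rewrite lee_fin mulr_ge0.
have F0 j v : 0 <= F j v by apply: mule_ge0; [rewrite lee_fin a0|exact: I0].
have mF j : measurable_fun setT (F j) by exact: measurable_funeM.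
(* The slack of the shell, a factor 2 inward under the power -g and 2 outward under the power s,
   produces 2^(g + s). *)
have ab j : (a j * (D * b j `^ s) = D * 2 `^ (g + s) * rho `^ (s - g) * x ^+ j)%R.
  have qj0 : (0 < q ^+ j)%R by exact: exprn_gt0.
  rewrite /a /b /x -(powR_mulrn j (powR_ge0 _ _)) -powRrM mulrC [((s - g) * _)%R]mulrC.
  rewrite powRrM powR_mulrn ?(ltW q0)//.
  rewrite !powRM ?mulr_ge0 ?invr_ge0 ?(ltW rho0) ?(ltW qj0) ?exprn_ge0 ?(ltW q0)//.
  rewrite -[(2^-1)%R]powR_inv1// -powRrM mulN1r opprK.
  by rewrite !powRD ?(gt_eqF rho0) ?(gt_eqF qj0) ?pnatr_eq0 ?implybT//; ring.
apply: (@le_trans _ _ (\int[mu]_v \sum_(0 <= j <oo) F j v)).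
  apply: ge0_le_integral => //.
  - by move=> v _; rewrite lee_fin mulr_ge0.
  - by apply/measurable_EFinP; exact: measurable_funM.
  - exact: ge0_emeasurable_sum.
  move=> v _; have [->|[j [Nl Nu hv]]] := Hh v.
    by rewrite mul0r nneseries_ge0.
  (* The term of one shell containing v suffices; the rest of the series is nonnegative. *)
  apply: (@le_trans _ _ (F j v)); last first.
    by rewrite (@nneseriesD1 _ (F ^~ v) j xpredT)//= leeDl// nneseries_ge0.
  rewrite /F -EFinM lee_fin indicE mem_set//= mul1r ler_wpM2r//.
  apply: (le_trans hv); rewrite /a !powRN lef_pV2 ?posrE ?powR_gt0//.
  - by rewrite ge0_ler_powR// nnegrE ltW// ?(lt_le_trans _ Nl) ?mulr_gt0 ?divr_gt0 ?exprn_gt0.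
  - by rewrite (lt_le_trans _ Nl)// mulr_gt0// ?divr_gt0// exprn_gt0.
  - by rewrite mulr_gt0// ?divr_gt0// exprn_gt0.
rewrite integral_nneseries//.
apply: lime_le; first by apply: is_cvg_nneseries => j _ _; exact: integral_ge0.
near=> m.
apply: (@le_trans _ _ (\sum_(0 <= j < m) (a j * (D * b j `^ s))%:E)).
  apply: lee_sum => j _; rewrite ge0_integralZl//; last by rewrite lee_fin.
  by rewrite EFinM lee_wpmul2l ?lee_fin// HD.
rewrite sumEFin lee_fin (eq_bigr _ (fun j _ => ab j)) -mulr_sumr.
rewrite [leRHS]mulrAC ler_wpM2l ?mulr_ge0 ?powR_ge0//.
exact: geometric_sum_le.
Unshelve. all: by end_near. Qed.

End Dyadic.

(** * Size of the kernel *)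

Section KernelSize.
Variables (R : realType) (n : nat).
Local Notation H := (Hn R n).
Implicit Types (u v w : H).

(** Multiplication by the central element (0,s), written so that the horizontal part is unchanged by
    conversion. *)
Definition hvert (w : H) (s : R) : H := (w.1, ht w + s).

Lemma hx_vert w s j : hx (hvert w s) j = hx w j. Proof. by []. Qed.

Lemma hy_vert w s j : hy (hvert w s) j = hy w j. Proof. by []. Qed.

Lemma zsq_vert w s : zsq (hvert w s) = zsq w. Proof. by []. Qed.

Lemma hnorm_zsq0 w : zsq w = 0 -> hnorm w = Num.sqrt `|ht w|.
Proof.
move=> w0; apply/eqP; rewrite -(@eqrXn2 _ 4) ?hnorm_ge0 ?sqrtr_ge0// hnorm4 w0.
by rewrite expr0n add0r (exprM _ 2 2) sqr_sqrtr ?normr_ge0// real_normK ?num_real.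
Qed.

(** Vertical displacements count by their square root, so raising w by |w|^2/4 is a move of length
    |w|/2, the longest that the regularity estimate admits. *)
Lemma hdist_vert w s : hnorm (hmul (hinv (hvert w s)) w) = Num.sqrt `|s|.
Proof.
rewrite hnorm_zsq0; last first.
  by rewrite /zsq big1// => j _; rewrite !hE hx_vert hy_vert !addNr expr0n addr0.
rewrite ht_mul big1 => [|j _]; last by rewrite !hE hx_vert hy_vert; ring.
by rewrite /= mulr0 addr0 opprD addrAC addNr add0r normrN.
Qed.

(** Since (0,s) is central, this is the distance from w to the identity, whatever s is. *)
Lemma hdist_vert_axis w s : hnorm (hmul (hinv (hvert w s)) (hvert (hone R n) s)) = hnorm w.
Proof.
apply: hnorm_eq; congr (_ ^+ 2 + _).
  by apply: eq_bigr => j _; rewrite !hE !hx_vert !hy_vert !hE !addr0 !sqrrN.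
rewrite ht_mul big1 => [|j _]; last by rewrite !hE !hx_vert !hy_vert !hE; ring.
by rewrite /= -/(ht w) mulr0 addr0 add0r opprD addrNK sqrrN.
Qed.

Variables (k : H -> R) (C delta g : R).
Hypothesis C0 : 0 < C.
Hypothesis delta0 : 0 < delta.
Hypothesis g0 : 0 < g.
Hypothesis k_reg : forall u v, hnorm (hmul (hinv v) u) <= hnorm u / 2 ->
  `|k u - k v| <= C * hnorm (hmul (hinv v) u) `^ delta / hnorm u `^ (g + delta).
Hypothesis k_even : forall w, k (w.1, - ht w) = k w.

(** Bounding |v^-1 u|^delta by |u|^delta cancels delta in the denominator: one admissible move costs
    no more than the expected size of the kernel. *)
Lemma kernel_step u v : 0 < hnorm u -> hnorm (hmul (hinv v) u) <= hnorm u / 2 ->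
  `|k u - k v| <= C * hnorm u `^ (- g).
Proof.
move=> u0 uv; apply: (le_trans (k_reg uv)).
rewrite -mulrA ler_wpM2l ?(ltW C0)// powRD; last by rewrite (gt_eqF u0) implybT.
rewrite powRN ler_pdivrMr ?mulr_gt0 ?hnorm_powR_gt0//.
rewrite mulKf ?gt_eqF ?hnorm_powR_gt0//.
rewrite ge0_ler_powR ?nnegrE ?hnorm_ge0 ?(ltW delta0)//.
by apply: (le_trans uv); rewrite ler_pdivrMr// ler_peMr ?ler1n// hnorm_ge0.
Qed.

(* Raising w = (z,t), t >= 0, vertically by |w|^2 / 4 is one admissible step and
   multiplies |w|^4 by at least 17/16, so the errors form a geometric series. *)
Lemma kernel_vert : exists2 A : R, 0 < A & forall w s,
  0 <= ht w -> 0 < hnorm w -> 0 <= s ->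
  `|k w - k (hvert w s)| <= A * hnorm w `^ (- g).
Proof.
have [theta [th0 th4 th1]] : exists theta : R,
    [/\ 0 < theta, theta ^+ 4 = 17%:R / 16%:R & theta `^ (- g) < 1].
  exists ((17%:R / 16%:R) `^ 4%:R^-1); split.
  - by apply: powR_gt0; lra.
  - by rewrite -powR_mulrn ?powR_ge0// -powRrM mulVf ?pnatr_eq0// powRr1//; lra.
  - have e0 : 0 < 4%:R^-1 * g by rewrite mulr_gt0.
    rewrite powRN -powRrM invf_lt1 ?powR_gt0 ?divr_gt0//.
    have /(_ 1 (17%:R / 16%:R)) := @gt0_ltr_powR R _ e0.
    by rewrite powR1; apply; rewrite ?nnegrE//; lra.
(* The fixed point that closes the induction: C pays for the first step, and A theta^(-g) for the
   rest of the chain, which starts at norm at least theta |w|. *)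
have [A A0 A_eq] : exists2 A : R, 0 < A & A * theta `^ (- g) + C = A.
  exists (C / (1 - theta `^ (- g))); first by rewrite divr_gt0// subr_gt0.
  by field; rewrite subr_eq0 gt_eqF.
exists A => // w s t0 w0 s0.
have step v s' : 0 < hnorm v -> 0 <= s' -> s' <= hnorm v ^+ 2 / 4 ->
    `|k v - k (hvert v s')| <= C * hnorm v `^ (- g).
  move=> v0 s'0 s'v; apply: kernel_step => //; rewrite hdist_vert ger0_norm//.
  rewrite -(@ler_pXn2r _ 2) ?nnegrE ?sqrtr_ge0 ?divr_ge0 ?(ltW v0)// sqr_sqrtr//.
  by rewrite expr_div_n -natrX.
(* The induction runs on a bound m for the number of steps counted with the initial step size; steps
   only grow along the chain, so the bound drops by one each time. *)
have [m sm] : exists m : nat, s <= hnorm w ^+ 2 / 4 * m%:R.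
  exists (Num.truncn (s / (hnorm w ^+ 2 / 4))).+1.
  by rewrite mulrC -ler_pdivrMr ?divr_gt0 ?exprn_gt0// ltW// truncnS_gt.
elim: m w s t0 w0 s0 sm => [|m IH] w s t0 w0 s0 sm.
  have -> : s = 0 by apply/eqP; rewrite eq_le s0 andbT; move: sm; rewrite mulr0.
  have -> : hvert w 0 = w by case: w {t0 w0 sm} => p t; rewrite /hvert /ht/= addr0.
  by rewrite subrr normr0 mulr_ge0 ?powR_ge0 ?ltW.
have [sw|ws] := leP s (hnorm w ^+ 2 / 4).
  apply: (le_trans (step _ _ w0 s0 sw)); rewrite ler_wpM2r ?powR_ge0//.
  by rewrite -A_eq lerDr mulr_ge0 ?powR_ge0 ?ltW.
set s1 := hnorm w ^+ 2 / 4.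
have s10 : 0 < s1 by rewrite divr_gt0 ?exprn_gt0.
pose b := hvert w s1.
(* As t >= 0, (t + s1)^2 >= t^2 + s1^2, and s1^2 = |w|^4 / 16. *)
have wb : theta * hnorm w <= hnorm b.
  rewrite hnorm_ge ?mulr_ge0 ?(ltW th0) ?(ltW w0)// exprMn th4.
  rewrite zsq_vert /= -/(ht w).
  have -> : 17 / 16 * hnorm w ^+ 4 = hnorm w ^+ 4 + s1 ^+ 2 by rewrite /s1; field.
  by have := mulr_ge0 t0 (ltW s10); rewrite hnorm4 => ts; nra.
have tw0 : 0 < theta * hnorm w by rewrite mulr_gt0.
have b0 : 0 < hnorm b by exact: lt_le_trans wb.
have w1b : hnorm w <= hnorm b.
  rewrite hnorm_ge ?(ltW w0)// hnorm4 -[zsq b]/(zsq w) -[ht b]/(ht w + s1) lerD2l.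
  by rewrite ler_pXn2r ?nnegrE ?addr_ge0 ?(ltW s10)// lerDl ltW.
have -> : hvert w s = hvert b (s - s1).
  by rewrite /b /hvert /ht /=; congr pair; ring.
have IHb : `|k b - k (hvert b (s - s1))| <= A * hnorm b `^ (- g).
  apply: IH => //; first by rewrite /b/= addr_ge0 ?(ltW s10).
    by rewrite subr_ge0 ltW.
  rewrite lerBlDr (le_trans sm)// -[m.+1%:R]natr1 mulrDr mulr1 lerD2r ler_wpM2r//.
  by rewrite ler_pM2r// ler_pXn2r ?nnegrE ?hnorm_ge0.
have -> : k w - k (hvert b (s - s1)) = (k w - k b) + (k b - k (hvert b (s - s1))) by ring.
apply: (le_trans (ler_normD _ _)).
apply: (@le_trans _ _ (C * hnorm w `^ (- g) + A * hnorm b `^ (- g))).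
  by apply: lerD; [exact: (step _ _ w0 (ltW s10) (lexx _))|exact: IHb].
have hb : hnorm b `^ (- g) <= theta `^ (- g) * hnorm w `^ (- g).
  rewrite -powRM ?hnorm_ge0 ?(ltW th0)// !powRN lef_pV2 ?posrE.
  - by rewrite ge0_ler_powR ?nnegrE ?hnorm_ge0 ?(ltW g0) ?(ltW tw0).
  - exact: hnorm_powR_gt0.
  - exact: powR_gt0.
move: (hnorm b `^ (- g)) (theta `^ (- g)) (hnorm w `^ (- g)) hb A_eq => x y z xyz Ay.
have -> : A * z = C * z + A * (y * z) by rewrite -{1}Ay; ring.
by rewrite lerD2l ler_wpM2l// ltW.
Qed.

(** Raising w = (z,t) to (z,t+S^2) costs the chain. That point is at distance |w| <= S/2 from the
    reference point (0,S^2) of norm S, so one step based at the reference point finishes. *)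
Lemma kernel_size : exists2 A : R, 0 < A & forall w S,
  0 < hnorm w -> 2 * hnorm w <= S ->
  `|k w - k (hvert (hone R n) (S ^+ 2))| <= A * hnorm w `^ (- g).
Proof.
have [A A0 Avert] := kernel_vert; exists (A + C); first exact: addr_gt0.
move=> w S w0 wS.
(* For t < 0 a vertical rise would at first decrease the norm; evenness of k allows reflecting w
   instead. *)
wlog t0 : w w0 wS / 0 <= ht w.
  have [t0 /(_ w)|t0] := leP 0 (ht w); first exact.
  move=> /(_ (w.1, - ht w)).
  have -> : hnorm (w.1, - ht w) = hnorm w by apply: hnorm_eq; rewrite /= sqrrN.
  by rewrite k_even; apply=> //=; rewrite oppr_ge0 ltW.
have S0 : 0 < S by apply: (lt_le_trans _ wS); rewrite mulr_gt0.
set e := hvert (hone R n) (S ^+ 2).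
have eS : hnorm e = S.
  by rewrite hnorm_zsq0 ?zsq_vert ?zsq_one//= add0r normrX sqrtr_sqr !normr_id gtr0_norm.
have -> : k w - k e = (k w - k (hvert w (S ^+ 2))) - (k e - k (hvert w (S ^+ 2))) by ring.
apply: (le_trans (ler_normB _ _)).
rewrite mulrDl; apply: lerD; first by apply: Avert => //; exact: sqr_ge0.
apply: (@le_trans _ _ (C * hnorm e `^ (- g))).
  apply: kernel_step; rewrite eS// hdist_vert_axis ler_pdivlMr//.
  by rewrite mulrC.
rewrite eS ler_wpM2l ?(ltW C0)// !powRN lef_pV2 ?posrE.
- rewrite ge0_ler_powR ?nnegrE ?hnorm_ge0 ?(ltW g0) ?(ltW S0)//.
  by rewrite (le_trans _ wS)// ler_peMl ?hnorm_ge0// ler1n.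
- exact: powR_gt0.
- exact: hnorm_powR_gt0.
Qed.

End KernelSize.

(** * Volume of balls and measurability of the kernel *)

Section BallVolume.
Variables (R : realType) (n : nat).
Local Notation H := (Hn R n).
Implicit Types (u v w a : H) (g : H -> \bar R).

Lemma measurable_hball u r : measurable (hball u r).
Proof.
rewrite -[X in measurable X]setTI; apply: measurable_fun_ltr => //.
by apply: measurable_hnorm; exact: measurable_hmul.
Qed.

Lemma hinv1 : hinv (hone R n) = hone R n.
Proof. by apply: hn_ext => [j|j|]; rewrite ?hE ?oppr0//= oppr0. Qed.

Local Open Scope ereal_scope.

Lemma hvolE (mu : {measure set H -> \bar R}) (E : set H) :
  (forall g, measurable_fun setT g -> (forall v, 0 <= g v) -> hint g = \int[mu]_v g v) ->
  measurable E -> hvol E = mu E.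
Proof.
move=> muE mE; rewrite /hvol muE ?integral_indic ?setIT//.
by apply/measurable_EFinP; exact: measurable_indic.
Qed.

(** Translation and dilation reduce every ball to the unit ball. Its volume is finite because the
    box [-1,1]^(2n+1) contains it, and positive because a large dilate contains the box. *)
Lemma hvol_ball : exists2 c : R, (0 < c)%R & forall u r, (0 < r)%R ->
  hvol (hball u r) = (c * r ^+ (2 * n + 2))%:E.
Proof.
have [mu muE] := hint_measure R n.
pose B := hball (hone R n) 1.
have mB : measurable_fun setT (fun v => (\1_B v)%:E : \bar R).
  by apply/measurable_EFinP; apply: measurable_indic; exact: measurable_hball.
have inB u (r : R) v : (0 < r)%R -> hball u r (hmul u (hdil r v)) = B v.
  move=> r0; rewrite /B /hball /= hinv1 hmul1h hmulKh hnorm_dil ?(ltW r0)//.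
  by rewrite -ltr_pdivlMl// mulVf ?gt_eqF.
have scale u (r : R) : (0 < r)%R -> hvol (hball u r) = (r ^+ (2 * n + 2))%:E * hvol B.
  move=> r0; have mb : measurable_fun setT (fun v => (\1_(hball u r) v)%:E : \bar R).
    by apply/measurable_EFinP; apply: measurable_indic; exact: measurable_hball.
  have := @hint_affine R n r u (fun v => (\1_(hball u r) v)%:E) r0 mb
    (fun v => ltac:(by rewrite lee_fin)).
  rewrite (_ : (fun v => _) = (fun v => (\1_B v)%:E)); last first.
    apply/funext => v; congr (_%:E); rewrite !indicE; congr ((_ : bool)%:R).
    by apply/idP/idP; rewrite !inE inB.
  rewrite -/(hvol (hball u r)) -/(hvol B) => ->.
  by rewrite muleA -EFinM -exprMn mulfV ?gt_eqF// expr1n mul1e.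
pose I11 : set R := `[(-1)%R, 1%R]%classic.
pose cube v := ((\prod_(j < n) \1_I11 (hx v j)) * (\prod_(j < n) \1_I11 (hy v j)) *
    \1_I11 (ht v))%R : R.
have hcube : hint (fun v => (cube v)%:E) = (2 ^+ (2 * n + 1))%:E by exact: hint_cube.
have cube0 v : (0 <= cube v)%R by rewrite !mulr_ge0 ?prodr_ge0.
have m11 : measurable_fun setT (\1_I11 : R -> R).
  by apply: measurable_indic; exact: measurable_itv.
have mcube : measurable_fun setT (fun v => (cube v)%:E).
  apply/measurable_EFinP; apply: measurable_funM; [apply: measurable_funM|].
  - apply: (@measurable_prod _ _ _ _ _ _ (fun j v => \1_I11 (hx v j))) => j _.
    exact: (measurableT_comp m11 (@measurable_hx R n j)).
  - apply: (@measurable_prod _ _ _ _ _ _ (fun j v => \1_I11 (hy v j))) => j _.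
    exact: (measurableT_comp m11 (@measurable_hy R n j)).
  - exact: (measurableT_comp m11 (@measurable_ht R n)).
have in11 (x : R) : (x ^+ 2 <= 1)%R -> \1_I11 x = 1%R :> R.
  move=> x1; rewrite indicE mem_set// /I11 /= in_itv/=.
  by rewrite -ler_norml -(@ler_pXn2r _ 2)// ?nnegrE// real_normK ?num_real// expr1n.
have finB : hvol B <= (2 ^+ (2 * n + 1))%:E.
  rewrite -hcube /hvol !muE//.
  apply: ge0_le_integral => //.
  move=> v _; rewrite lee_fin indicE; case: (boolP (v \in B)) => // vB.
  move: vB; rewrite inE /B /hball /= hinv1 hmul1h => v1.
  have v4 : (zsq v ^+ 2 + ht v ^+ 2 <= 1)%R.
    by rewrite -hnorm4 exprn_ile1 ?hnorm_ge0// ltW.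
  have z1 : (zsq v <= 1)%R.
    rewrite -(@ler_pXn2r _ 2)// ?nnegrE ?zsq_ge0// expr1n.
    by apply: (le_trans _ v4); rewrite lerDl sqr_ge0.
  have xy j : (hx v j ^+ 2 + hy v j ^+ 2 <= 1)%R.
    apply: (le_trans _ z1); rewrite /zsq (bigD1 j)//= lerDl.
    by apply: sumr_ge0 => i _; rewrite addr_ge0 ?sqr_ge0.
  rewrite /cube !big1 ?mul1r => [|j _|j _].
  - by rewrite in11//; apply: (le_trans _ v4); rewrite lerDr sqr_ge0.
  - by rewrite in11//; apply: (le_trans _ (xy j)); rewrite lerDr sqr_ge0.
  - by rewrite in11//; apply: (le_trans _ (xy j)); rewrite lerDl sqr_ge0.
(* On the box |z|^2 <= 2n and t^2 <= 1, hence |(z,t)|^4 <= (2n)^2 + 1 < (2n + 2)^4. *)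
pose r0 : R := (2 * n + 2)%:R.
have r00 : (0 < r0)%R by rewrite ltr0n addn2.
have posB : (2 ^+ (2 * n + 1))%:E <= hvol (hball (hone R n) r0).
  have mb : measurable_fun setT (fun v => (\1_(hball (hone R n) r0) v)%:E : \bar R).
    by apply/measurable_EFinP; apply: measurable_indic; exact: measurable_hball.
  rewrite -hcube /hvol !muE//.
  apply: ge0_le_integral => //; first by move=> v _; rewrite lee_fin.
  have le1 (x : R) : (\1_I11 x <= 1 :> R)%R by rewrite indicE; case: (_ \in _).
  have p1 (f : 'I_n -> R) : (\prod_(j < n) \1_I11 (f j) <= 1 :> R)%R.
    rewrite -[leRHS](@big1_eq _ 1%R *%R _ (index_enum 'I_n) xpredT) ler_prod// => j _.
    by rewrite le1 andbT.
  move=> v _; rewrite lee_fin indicE; case: (boolP (v \in _)) => [_|].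
    rewrite /cube -[leRHS]mulr1 ler_pM ?mulr_ge0 ?prodr_ge0// -[leRHS]mulr1.
    by rewrite ler_pM ?prodr_ge0.
  rewrite notin_setE /hball /= hinv1 hmul1h => /negP; rewrite -leNgt => vr.
  have [->//|/eqP c0] := eqVneq (cube v) 0%R; exfalso.
  have out x : \1_I11 x != 0%R :> R -> (x ^+ 2 <= 1)%R.
    rewrite indicE; case: (boolP (x \in I11)); rewrite ?eqxx// inE /I11 /= in_itv/=.
    rewrite -ler_norml => x1 _.
    by rewrite -real_normK ?num_real// exprn_ile1.
  move: c0; rewrite /cube => /eqP; rewrite !mulf_eq0 !negb_or => /andP[/andP[cx cy] ct].
  have hxj j : (hx v j ^+ 2 <= 1)%R.
    by apply: out; move: cx => /prodf_neq0; apply.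
  have hyj j : (hy v j ^+ 2 <= 1)%R.
    by apply: out; move: cy => /prodf_neq0; apply.
  have z2 : (zsq v <= 2 * n%:R)%R.
    apply: (@le_trans _ _ (\sum_(j < n) 2)%R).
      by apply: ler_sum => j _; have := hxj j; have := hyj j; lra.
    by rewrite sumr_const card_ord mulr_natr.
  move: vr; rewrite hnorm_ge ?(ltW r00)//; apply/negP; rewrite -ltNge.
  have -> : r0 = (2 * n%:R + 2)%R by rewrite /r0 natrD natrM.
  have := out _ ct; have := zsq_ge0 v.
  move: (zsq v) (ht v ^+ 2)%R (n%:R : R) (ler0n R n) z2 => z t N N0 zN z0 t1.
  have : (z ^+ 2 <= (2 * N) ^+ 2)%R by rewrite ler_pXn2r ?nnegrE// mulr_ge0.
  by move=> zz; nra.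
have [c vc] : exists c : R, hvol B = c%:E.
  exists (fine (hvol B)); rewrite fineK// ge0_fin_numE ?(le_lt_trans finB) ?ltry//.
  by rewrite (hvolE muE) ?measure_ge0//; exact: measurable_hball.
exists c.
  move: posB; rewrite scale// vc -EFinM lee_fin => /(lt_le_trans _) h.
  have := h _ (exprn_gt0 _ (ltr0Sn R 1)).
  by rewrite pmulr_rgt0// exprn_gt0.
by move=> u r r1; rewrite scale// vc -EFinM mulrC.
Qed.

End BallVolume.

(** * Measurability of the heat kernel and of its time integral *)

Section KernelMeasurable.
Variable R : realType.
Local Notation leb := (@lebesgue_measure R).

(** Continuity fails at 0, so the inverse is written x (x^2)^(-1) with a real power; both sides
    vanish at 0 by the convention 0^-1 = 0. *)
Lemma measurable_inv : measurable_fun setT (fun x : R => x^-1).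
Proof.
rewrite (_ : (fun x : R => _) = (fun x => x * (x ^+ 2) `^ (- 1))).
  apply: measurable_funM => //; apply: (measurableT_comp (measurable_powR _)).
  exact: measurable_funX.
apply/funext => x; rewrite powR_inv1 ?sqr_ge0//.
have [->|x0] := eqVneq x 0; first by rewrite mul0r invr0.
by field.
Qed.

Lemma measurable_cos : measurable_fun setT (@cos R).
Proof. apply: continuous_measurable_fun; exact: continuous_cos. Qed.

(** Valid whether or not the integrals converge: [Rintegral] is [fine] of a difference of integrals
    of positive and negative parts, each measurable in x by Tonelli. *)
Lemma measurable_Rintegral d (T : measurableType d) (D : set R) (F : T * R -> R) :
  measurable D -> measurable_fun setT F ->
  measurable_fun setT (fun x => Rintegral leb D (fun s => F (x, s))).
Proof.
move=> mD mF; apply: (measurableT_comp (fine_measurable measurableT)).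
pose G (p : T * R) := (\1_D p.2 * F p)%:E.
have mG : measurable_fun setT G.
  apply/measurable_EFinP; apply: measurable_funM => //.
  exact: (measurableT_comp (measurable_indic mD) measurable_snd).
rewrite (_ : (fun x => _) = (fun x =>
    \int[leb]_s G^\+ (x, s) - \int[leb]_s G^\- (x, s))%E); last first.
  apply/funext => x; rewrite integral_mkcond integralE.
  congr (_ - _)%E; apply: eq_integral => s _.
    by rewrite !funeposE /G /= /patch indicE; case: (s \in D); rewrite ?mul1r ?mul0r//.
  by rewrite !funenegE /G /= /patch indicE; case: (s \in D); rewrite ?mul1r ?mul0r//.
apply: emeasurable_funB.
- have mGp : measurable_fun setT G^\+%E by exact: measurable_funepos.
  exact: (@measurable_fun_fubini_tonelli_F _ _ T (measurableTypeR R) _ leb G^\+%E mGp).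
- have mGn : measurable_fun setT G^\-%E by exact: measurable_funeneg.
  exact: (@measurable_fun_fubini_tonelli_F _ _ T (measurableTypeR R) _ leb G^\-%E mGn).
Qed.

Lemma measurable_sinhR : measurable_fun setT (@sinhR R).
Proof.
apply: measurable_funM => //; apply: measurable_funB => //.
by apply: (measurableT_comp (@measurable_expR R)); exact: measurable_funN.
Qed.

Lemma measurable_cothR : measurable_fun setT (@cothR R).
Proof.
have mN : measurable_fun setT (fun x : R => expR (- x)).
  by apply: (measurableT_comp (@measurable_expR R)); exact: measurable_funN.
apply: measurable_funM; first exact: measurable_funD.
apply: (measurableT_comp measurable_inv); exact: measurable_funB.
Qed.

Lemma measurable_heat n : measurable_fun setT (fun p : Hn R n * R => heat p.2 p.1).
Proof.
apply: measurable_funM => //.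
pose F (q : (Hn R n * R) * R) := cos (q.2 * ht q.1.1) *
  (q.2 / (pi * sinhR (4 * q.2 * q.1.2))) ^+ n *
  expR (- (q.2 * cothR (4 * q.2 * q.1.2)) * zsq q.1.1).
apply: (@measurable_Rintegral _ _ setT F) => //.
have mw : measurable_fun setT (fun q : (Hn R n * R) * R => q.1.1).
  exact: (measurableT_comp measurable_fst measurable_fst).
have ms : measurable_fun setT (fun q : (Hn R n * R) * R => q.1.2).
  exact: (measurableT_comp measurable_snd measurable_fst).
have ml : measurable_fun setT (fun q : (Hn R n * R) * R => q.2) by exact: measurable_snd.
have mls : measurable_fun setT (fun q : (Hn R n * R) * R => 4 * q.2 * q.1.2).
  by apply: measurable_funM => //; exact: measurable_funM.
apply: measurable_funM; first apply: measurable_funM.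
- apply: (measurableT_comp measurable_cos); apply: measurable_funM => //.
  exact: (measurableT_comp (@measurable_ht R n) mw).
- apply: measurable_funX; apply: measurable_funM => //.
  apply: (measurableT_comp measurable_inv); apply: measurable_funM => //.
  exact: (measurableT_comp measurable_sinhR mls).
- apply: (measurableT_comp (@measurable_expR R)); apply: measurable_funM.
    apply: measurable_funN; apply: measurable_funM => //.
    exact: (measurableT_comp measurable_cothR mls).
  exact: (measurableT_comp (@measurable_zsq R n) mw).
Qed.

Definition kern n (alpha : R) (w : Hn R n) : R :=
  (Gamma (alpha / 2))^-1 *
  Rintegral leb [set s : R | 0 < s] (fun s => heat s w * s `^ (alpha / 2 - 1)).

Lemma KalphaE n alpha (u v : Hn R n) : Kalpha alpha u v = kern alpha (hmul (hinv v) u).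
Proof. by []. Qed.

(** The variable t enters only through cos(l t). *)
Lemma kern_even n alpha (w : Hn R n) : kern alpha (w.1, - ht w) = kern alpha w.
Proof.
rewrite /kern; congr (_ * _); apply: eq_Rintegral => s _; congr (_ * _).
rewrite /heat; congr (_ * _); apply: eq_Rintegral => l _.
by rewrite /= mulrN cosN.
Qed.

Lemma measurable_kern n alpha : measurable_fun setT (@kern n alpha).
Proof.
apply: measurable_funM => //.
apply: (@measurable_Rintegral _ _ _
  (fun p : Hn R n * R => heat p.2 p.1 * p.2 `^ (alpha / 2 - 1))).
  rewrite (_ : [set s | _] = `]0, +oo[%classic); first exact: measurable_itv.
  by apply/seteqP; split=> s; rewrite /= in_itv/= andbT.
apply: measurable_funM; first exact: measurable_heat.
exact: (measurableT_comp (measurable_powR _) measurable_snd).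
Qed.

End KernelMeasurable.

(** * Oscillation and Morrey bounds *)

Section Oscillation.
Variables (R : realType) (n : nat).
Local Notation H := (Hn R n).
Local Notation Q := (hQ R n).
Local Notation dist u v := (hnorm (hmul (hinv u) v)).
Implicit Types (u v w : H) (f : H -> R).
Variable mu : {sigma_finite_measure set H -> \bar R}.
Hypothesis muE : forall g : H -> \bar R,
  measurable_fun setT g -> (forall v, (0 <= g v)%E) -> hint g = (\int[mu]_v g v)%E.
Variable c : R.
Hypothesis c0 : 0 < c.
Hypothesis vol_ball : forall u r, 0 < r -> hvol (hball u r) = (c * r `^ Q)%:E.

Let mu_ball u r : 0 < r -> mu (hball u r) = (c * r `^ Q)%:E.
Proof. by move=> r0; rewrite -(vol_ball u)// (hvolE muE)//; exact: measurable_hball. Qed.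

Let Q0 : 0 < Q. Proof. by rewrite /hQ ltr0n addn2. Qed.

Lemma measurable_dist u : measurable_fun setT (fun v => dist u v).
Proof. by apply: measurable_hnorm; exact: measurable_hmul. Qed.

Lemma measurable_ball_indic u r : measurable_fun setT (\1_(hball u r) : H -> R).
Proof. by apply: measurable_indic; exact: measurable_hball. Qed.

Local Open Scope ereal_scope.

Lemma integral_ball_cst u r (a : R) : (0 < r)%R -> (0 <= a)%R ->
  \int[mu]_v (\1_(hball u r) v * a)%:E = (a * (c * r `^ Q))%:E.
Proof.
move=> r0 a0; under eq_integral do rewrite mulrC EFinM.
rewrite ge0_integralZl//.
  have mb := measurable_hball u r; rewrite integral_indic// setIT EFinM.
  by congr (_ * _); exact: mu_ball.
by apply/measurable_EFinP; exact: measurable_ball_indic.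
Qed.

(** [hintS] subtracts two [fine] values, and [fine] sends an infinite part to 0. Under absolute
    convergence both parts are finite, and linearity becomes available. *)
Lemma hintS_integral (E : set H) f : measurable E -> measurable_fun setT f ->
  \int[mu]_v (\1_E v * `|f v|)%:E < +oo ->
  (hintS E f)%:E = \int[mu]_v (\1_E v * f v)%:E.
Proof.
move=> mE mf foo.
pose G v := (\1_E v * f v)%:E : \bar R.
have mI : measurable_fun setT (\1_E : H -> R) by exact: measurable_indic.
have mG : measurable_fun setT G by apply/measurable_EFinP; exact: measurable_funM.
have iG : mu.-integrable setT G.
  apply/integrableP; split=> //; move: foo; congr (_ < _); apply: eq_integral => v _.
  by rewrite /G /= normrM ger0_norm.
have pE : (fun v => (\1_E v * Num.max (f v) 0)%:E) = G^\+ :> (H -> \bar R).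
  apply/funext => v; rewrite funeposE /G -EFin_max.
  by rewrite indicE; case: (_ \in _); rewrite ?mul1r// !mul0r maxxx.
have nE : (fun v => (\1_E v * Num.max (- f v) 0)%:E) = G^\- :> (H -> \bar R).
  apply/funext => v; rewrite funenegE /G -EFinN -EFin_max.
  by rewrite indicE; case: (_ \in _); rewrite ?mul1r// !mul0r oppr0 maxxx.
rewrite /hintS pE nE !muE//; last 2 first.
- exact: measurable_funeneg.
- exact: measurable_funepos.
rewrite EFinB !fineK ?integrable_pos_fin_num ?integrable_neg_fin_num//.
by rewrite -integralE.
Qed.

(* Any constant may replace the mean value, at the price of a factor 2. *)
Lemma oscillation_le f u r (a W : R) : (0 < r)%R -> measurable_fun setT f ->
  \int[mu]_v (\1_(hball u r) v * `|f v - a|)%:E <= W%:E ->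
  \int[mu]_v (\1_(hball u r) v * `|f v|)%:E < +oo /\
  \int[mu]_v (\1_(hball u r) v * `|f v - havg (hball u r) f|)%:E <= (2 * W)%:E.
Proof.
move=> r0 mf fW.
have mB := @measurable_ball_indic u r.
have mfa (b : R) : measurable_fun setT (fun v => (\1_(hball u r) v * `|f v - b|)%:E).
  apply/measurable_EFinP; apply: measurable_funM => //.
  by apply: (measurableT_comp (@normr_measurable _ setT)); exact: measurable_funB.
have mcst (b : R) : measurable_fun setT (fun v => (\1_(hball u r) v * b)%:E).
  by apply/measurable_EFinP; exact: measurable_funM.
have shift (x y : R) (b : R) : \int[mu]_v (\1_(hball u r) v * `|f v - x|)%:E <= y%:E ->
    \int[mu]_v (\1_(hball u r) v * `|f v - b|)%:E <= (y + `|x - b| * (c * r `^ Q))%:E.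
  move=> fx.
  apply: (@le_trans _ _ (\int[mu]_v ((\1_(hball u r) v * `|f v - x|)%:E +
      (\1_(hball u r) v * `|x - b|)%:E))).
    apply: ge0_le_integral => //.
      exact: emeasurable_funD.
    move=> v _; rewrite -EFinD lee_fin -mulrDr ler_wpM2l//.
    by rewrite (_ : f v - b = (f v - x) + (x - b))%R ?ler_normD//; ring.
  rewrite ge0_integralD//; [|by move=> v _; rewrite lee_fin mulr_ge0..].
  by rewrite integral_ball_cst// EFinD leeD2r.
have foo : \int[mu]_v (\1_(hball u r) v * `|f v|)%:E < +oo.
  have := shift _ _ 0%R fW; under eq_integral do rewrite subr0.
  by move=> /le_lt_trans; apply; rewrite ltry.
split=> //.
have V0 : (0 < c * r `^ Q)%R by rewrite mulr_gt0// powR_gt0.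
set m := havg _ _.
have iB (b : R) : mu.-integrable setT (fun v => (\1_(hball u r) v * (f v - b))%:E).
  apply/integrableP; split.
    apply/measurable_EFinP; apply: measurable_funM => //; exact: measurable_funB.
  apply: le_lt_trans (ltry (W + `|a - b| * (c * r `^ Q))%R).
  apply: le_trans (shift _ _ b fW); rewrite le_eqVlt; apply/orP; left; apply/eqP.
  by apply: eq_integral => v _; rewrite /= normrM ger0_norm.
have mE : (m * (c * r `^ Q))%:E = \int[mu]_v (\1_(hball u r) v * f v)%:E.
  rewrite -hintS_integral//; last exact: measurable_hball.
  rewrite /m /havg vol_ball//=.
  by rewrite -mulrA mulVf ?mulr1// gt_eqF.
(* As m |B| is the integral of f over B, (a - m) |B| is up to sign the integral of f - a over B. *)
have am : (`|a - m| * (c * r `^ Q) <= W)%R.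
  rewrite -[X in (_ * X)%R]gtr0_norm// -normrM -lee_fin.
  apply: le_trans fW.
  have -> : (`|(a - m) * (c * r `^ Q)|%:E =
      `| \int[mu]_v (\1_(hball u r) v * (f v - a))%:E |).
    have -> : \int[mu]_v (\1_(hball u r) v * (f v - a))%:E =
        (m * (c * r `^ Q))%:E - (a * (c * r `^ Q))%:E.
      rewrite mE.
      have i0 : mu.-integrable setT (fun v => (\1_(hball u r) v * f v)%:E).
        by have := iB 0%R; under eq_fun do rewrite subr0.
      have i1 : mu.-integrable setT (fun v => (\1_(hball u r) v * a)%:E).
        apply/integrableP; split => //.
        rewrite (_ : \int[mu]_v _ = \int[mu]_v (\1_(hball u r) v * `|a|)%:E).
          by rewrite integral_ball_cst// ltry.
        by apply: eq_integral => v _; rewrite /= normrM ger0_norm.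
      have -> : (a * (c * r `^ Q))%:E = \int[mu]_v (\1_(hball u r) v * a)%:E.
        have [a0|a0] := leP 0%R a; first by rewrite integral_ball_cst.
        rewrite -{1}[a]opprK mulNr EFinN -(integral_ball_cst u) ?oppr_ge0 ?(ltW a0)//.
        rewrite -integral_ge0N; last by move=> v _; rewrite lee_fin mulr_ge0// oppr_ge0 ltW.
        by apply: eq_integral => v _; rewrite -EFinN mulrN opprK.
      rewrite -integralB_EFin//; apply: eq_integral => v _.
      by rewrite -EFinB -mulrBr.
    by rewrite -EFinB /= -mulrBl -normrN -mulNr opprB.
  apply: (le_trans (le_abse_integral _ _ _)) => //.
    exact: measurable_int (iB a).
  rewrite le_eqVlt; apply/orP; left; apply/eqP.
  by apply: eq_integral => v _; rewrite /= normrM ger0_norm.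
apply: (le_trans (shift _ _ m fW)); rewrite lee_fin mulr_natl mulr2n lerD2l//.
Qed.

(** Hölder's inequality up to a factor 2, obtained by integrating the pointwise bound t <= lam^(1-p)
    t^p + lam, which covers p = 1 as well. *)
Lemma morrey_ball (p kappa M : R) f u r : (1 <= p)%R -> (0 < M)%R -> (0 < r)%R ->
  measurable_fun setT f -> morrey_norm p kappa f <= M%:E ->
  \int[mu]_v (\1_(hball u r) v * `|f v|)%:E <=
    (2 * M * (c * r `^ Q) `^ (1 - (1 - kappa) / p))%:E.
Proof.
move=> p1 M0 r0 mf fM.
have p0 : (0 < p)%R by exact: lt_le_trans p1.
set V := (c * r `^ Q)%R; have V0 : (0 < V)%R by rewrite mulr_gt0// powR_gt0.
have mB := @measurable_ball_indic u r.
have mn : measurable_fun setT (fun v => `|f v|%R).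
  exact: (measurableT_comp (@normr_measurable _ setT)).
have mp : measurable_fun setT (fun v => (\1_(hball u r) v * `|f v| `^ p)%:E).
  apply/measurable_EFinP; apply: measurable_funM => //.
  exact: (measurableT_comp (measurable_powR _)).
have p_ge0 v : 0 <= (\1_(hball u r) v * `|f v| `^ p)%:E :> \bar R.
  by rewrite lee_fin mulr_ge0// powR_ge0.
have : morrey_quot p kappa f u r <= M%:E.
  by apply: le_trans fM; apply: ereal_sup_ubound; exists u, r.
rewrite /morrey_quot muE// vol_ball//=.
rewrite -/V.
have : 0 <= \int[mu]_v (\1_(hball u r) v * `|f v| `^ p)%:E by exact: integral_ge0.
case E : (\int[mu]_v _) => [x| |//]; last first.
  by rewrite mulry gtr0_sg ?powR_gt0// mul1e poweRyr ?gt_eqF ?invr_gt0.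
rewrite lee_fin -EFinM poweR_EFin lee_fin => x0 xM.
have {}xM : (x <= M `^ p * V `^ kappa)%R.
  rewrite -ler_pdivrMr ?powR_gt0// -powRN mulrC.
  have y0 : (0 <= V `^ (- kappa) * x)%R by rewrite mulr_ge0// powR_ge0.
  rewrite -[leLHS]powRr1// -(mulVf (lt0r_neq0 p0)) powRrM.
  by rewrite ge0_ler_powR ?nnegrE ?powR_ge0 ?(ltW p0) ?(ltW M0).
(* Chosen so that lam^p V = M^p V^kappa: both terms of the pointwise bound then integrate to at most
   lam V. *)
set lam := (M * V `^ ((kappa - 1) / p))%R.
have lam0 : (0 < lam)%R by rewrite mulr_gt0// powR_gt0.
have young (t : R) : (0 <= t)%R -> (t <= lam `^ (1 - p) * t `^ p + lam)%R.
  move=> t0; have [tl|lt] := leP t lam.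
    by apply: (le_trans tl); rewrite lerDr mulr_ge0// powR_ge0.
  have t1 : (0 < t)%R by exact: lt_trans lt.
  apply: (@le_trans _ _ (lam `^ (1 - p) * t `^ p)%R); last by rewrite lerDl ltW.
  apply: (@le_trans _ _ (t `^ (1 - p) * t `^ p)%R).
    by rewrite -powRD ?(gt_eqF t1) ?implybT// subrK powRr1// ltW.
  rewrite ler_wpM2r ?powR_ge0// -opprB; apply: powRN_le => //; last exact: ltW.
  by rewrite subr_ge0.
apply: (@le_trans _ _ (\int[mu]_v ((lam `^ (1 - p))%:E * (\1_(hball u r) v * `|f v| `^ p)%:E +
    (\1_(hball u r) v * lam)%:E))).
  apply: ge0_le_integral => //.
  - by apply/measurable_EFinP; exact: measurable_funM.
  - apply: emeasurable_funD; first exact: measurable_funeM.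
    by apply/measurable_EFinP; exact: measurable_funM.
  move=> v _; rewrite -EFinM -EFinD lee_fin mulrCA -mulrDr ler_wpM2l// young//.
rewrite ge0_integralD//; last 4 first.
- by move=> v _; rewrite mule_ge0// lee_fin powR_ge0.
- exact: measurable_funeM.
- by move=> v _; rewrite lee_fin mulr_ge0// ltW.
- by apply/measurable_EFinP; exact: measurable_funM.
rewrite ge0_integralZl// ?lee_fin ?powR_ge0// E integral_ball_cst ?(ltW lam0)//.
rewrite -/V -EFinM -EFinD lee_fin.
have lamp : (lam `^ p * V = M `^ p * V `^ kappa)%R.
  rewrite /lam powRM ?powR_ge0 ?(ltW M0)// -powRrM mulfVK ?gt_eqF// -mulrA; congr (_ * _)%R.
  by rewrite -{2}[V]powRr1 ?(ltW V0)// -powRD ?(gt_eqF V0) ?implybT// subrK.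
have lamV : (lam * V = M * V `^ (1 - (1 - kappa) / p))%R.
  rewrite /lam -mulrA; congr (_ * _)%R.
  rewrite -{2}[V]powRr1 ?(ltW V0)// -powRD ?(gt_eqF V0) ?implybT//; congr (_ `^ _)%R.
  by rewrite -opprB mulNr addrC.
have -> : (2 * M * V `^ (1 - (1 - kappa) / p) = lam * V + lam * V)%R.
  by rewrite lamV; ring.
rewrite lerD2r.
apply: (@le_trans _ _ (lam `^ (1 - p) * (lam `^ p * V))%R).
  by rewrite lamp ler_wpM2l ?powR_ge0.
by rewrite mulrA -powRD ?(gt_eqF lam0) ?implybT// subrK powRr1// ltW.
Qed.

End Oscillation.

(** * The fractional integral *)

Section FractionalIntegral.
Variables (R : realType) (n : nat).
Local Notation H := (Hn R n).
Local Notation Q := (hQ R n).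
Local Notation dist u v := (hnorm (hmul (hinv u) v)).
Implicit Types (u v w : H) (f : H -> R).
Variable mu : {sigma_finite_measure set H -> \bar R}.
Hypothesis muE : forall g : H -> \bar R,
  measurable_fun setT g -> (forall v, (0 <= g v)%E) -> hint g = (\int[mu]_v g v)%E.
Variable c : R.
Hypothesis c0 : 0 < c.
Hypothesis vol_ball : forall u r, 0 < r -> hvol (hball u r) = (c * r `^ Q)%:E.

Let mu_ball u r : 0 < r -> mu (hball u r) = (c * r `^ Q)%:E.
Proof. by move=> r0; rewrite -(vol_ball u)// (hvolE muE)//; exact: measurable_hball. Qed.

Let Q0 : 0 < Q. Proof. by rewrite /hQ ltr0n addn2. Qed.

Local Open Scope ereal_scope.

(** The bound on the kernel says nothing at distance zero. That set lies in balls of arbitrarily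
    small volume, the radius solving c r^Q = e. *)
Lemma mu_center v : mu [set u | dist v u = 0%R] = 0.
Proof.
set Z := [set u | _].
have mZ : measurable Z.
  rewrite (_ : Z = setT `&` (fun u => dist v u) @^-1` [set 0%R]); last by rewrite setTI.
  exact: (@measurable_dist R n v).
apply/eqP; rewrite eq_le measure_ge0 andbT.
apply/lee_addgt0Pr => e e0; rewrite add0e.
pose r := ((e / c) `^ Q^-1)%R.
have r0 : (0 < r)%R by rewrite powR_gt0// divr_gt0.
have -> : e%:E = mu (hball v r).
  rewrite mu_ball// /r -powRrM mulVf ?gt_eqF// powRr1 ?divr_ge0 ?ltW//.
  by rewrite mulrC divfK// gt_eqF.
apply: le_measure; rewrite ?inE//; [exact: measurable_hball|].
by move=> u; rewrite /Z /hball /= => ->.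
Qed.

(** The outward summation, q = 2. It is applied with g + delta in the role of g, where s < g + delta
    will amount to beta < delta. *)
Lemma far_integral f (D s g rho : R) u : measurable_fun setT f -> (0 <= D)%R ->
  (forall r, (0 < r)%R -> \int[mu]_v (\1_(hball u r) v * `|f v|)%:E <= (D * r `^ s)%:E) ->
  (0 <= g)%R -> (s < g)%R -> (0 < rho)%R ->
  \int[mu]_v (\1_(~` hball u rho) v * dist u v `^ (- g) * `|f v|)%:E <=
    (D * 2 `^ (g + s) / (1 - 2 `^ (s - g)) * rho `^ (s - g))%:E.
Proof.
move=> mf D0 HD g0 sg rho0.
have md := @measurable_dist R n u.
apply: (@dyadic_integral_le R _ _ mu (fun v => dist u v) (fun v => `|f v|%R)
  (fun v => \1_(~` hball u rho) v * dist u v `^ (- g))%R _ _ _ 2) => //.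
- exact: (measurableT_comp (@normr_measurable _ setT)).
- apply: measurable_funM; last exact: (measurableT_comp (measurable_powR _)).
  by apply: measurable_indic; apply: measurableC; exact: measurable_hball.
- by move=> v; rewrite mulr_ge0// powR_ge0.
- by apply: powR_gt1_lt1; rewrite ?ltr1n// subr_lt0.
move=> v; rewrite indicE; case: (boolP (v \in _)); last by rewrite mul0r; left.
rewrite inE /hball /= => /negP; rewrite -leNgt => rv; right.
have x1 : (1 <= dist u v / rho)%R by rewrite ler_pdivlMr// mul1r.
have [j [jl ju]] := exp2_bracket x1.
exists j; split.
- move: jl; rewrite ler_pdivlMr// => jl; apply: le_trans jl; rewrite mulrC ler_wpM2l ?exprn_ge0//.
  by rewrite ler_pdivrMr// ler_peMr ?ler1n// ltW.
- by move: ju; rewrite ltr_pdivrMr// exprS mulrAC.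
- by rewrite mul1r.
Qed.

Section Kernel.
Variables (alpha delta A C : R) (k : H -> R).
Hypothesis alpha0 : (0 < alpha)%R.
Hypothesis alphaQ : (alpha < Q)%R.
Hypothesis delta0 : (0 < delta)%R.
Hypothesis A0 : (0 < A)%R.
Hypothesis C0 : (0 < C)%R.
Hypothesis mk : measurable_fun setT k.
Hypothesis k_size : forall w S, (0 < hnorm w)%R -> (2 * hnorm w <= S)%R ->
  (`|k w - k (hvert (hone R n) (S ^+ 2))| <= A * hnorm w `^ (- (Q - alpha)))%R.
Hypothesis k_reg : forall u v w, (dist v u <= dist w u / 2)%R ->
  (`|k (hmul (hinv w) u) - k (hmul (hinv w) v)| <=
     C * dist v u `^ delta / dist w u `^ (Q - alpha + delta))%R.

Let g : R := (Q - alpha)%R.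
Let g0 : (0 < g)%R. Proof. by rewrite subr_gt0. Qed.

(** A times the constant of [dyadic_integral_le] for q = 1/2, weight 1 and s = Q, where s - g =
    alpha. *)
Definition near_cst : R := (A * (c * 2 `^ (g + Q) / (1 - 2^-1 `^ alpha)))%R.

Lemma near_cst_gt0 : (0 < near_cst)%R.
Proof.
rewrite /near_cst !mulr_gt0 ?powR_gt0// invr_gt0 subr_gt0.
exact: powR_half_lt1.
Qed.

(** The singularity |w|^(alpha - Q) is integrable at the centre because alpha > 0. The height (2
    rho)^2 is that of a reference point serving all |w| < rho. *)
Lemma near_integral v (rho : R) : (0 < rho)%R ->
  \int[mu]_u (\1_(hball v rho) u *
    `|k (hmul (hinv v) u) - k (hvert (hone R n) ((2 * rho) ^+ 2))|)%:E <=
  (near_cst * rho `^ alpha)%:E.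
Proof.
move=> rho0; have md := @measurable_dist R n v.
have mB := @measurable_ball_indic R n v rho.
have mkv : measurable_fun setT (fun u => k (hmul (hinv v) u)).
  by apply: (measurableT_comp mk); exact: measurable_hmul.
pose h u := (\1_(hball v rho) u * dist v u `^ (- g))%R.
have h0 u : (0 <= h u)%R by rewrite mulr_ge0// powR_ge0.
have mh : measurable_fun setT h.
  by apply: measurable_funM => //; exact: (measurableT_comp (measurable_powR _)).
have mZ : measurable [set u | dist v u = 0%R].
  rewrite (_ : [set u | _] = setT `&` (fun u => dist v u) @^-1` [set 0%R]); last by rewrite setTI.
  exact: md.
apply: (@le_trans _ _ (\int[mu]_u (A%:E * (h u * 1)%:E))).
  apply: ae_ge0_le_integral => //.
  - apply/measurable_EFinP; apply: measurable_funM => //.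
    apply: (measurableT_comp (@normr_measurable _ setT)); exact: measurable_funB.
  - by move=> u _; rewrite -EFinM lee_fin mulr1 mulr_ge0// ltW.
  - by apply: measurable_funeM; apply/measurable_EFinP; exact: measurable_funM.
  exists [set u | dist v u = 0%R]; split => //; first exact: mu_center.
  move=> u /=; apply: contra_notP => /eqP u0 _.
  rewrite -EFinM lee_fin mulr1 /h indicE; case: (boolP (u \in _)) => [|_].
    rewrite inE /hball /= => ur; rewrite !mul1r; apply: k_size.
      by rewrite lt_def u0 hnorm_ge0.
    by rewrite ler_pM2l// ltW.
  by rewrite !mul0r mulr0.
rewrite ge0_integralZl ?lee_fin ?(ltW A0)//; last 2 first.
- by apply/measurable_EFinP; exact: measurable_funM.
- by move=> u _; rewrite lee_fin mulr_ge0.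
rewrite /near_cst -mulrA EFinM lee_wpmul2l ?lee_fin ?(ltW A0)//.
have -> : alpha = (Q - g)%R by rewrite /g; ring.
apply: (@dyadic_integral_le R _ _ mu (fun v' => dist v v') (fun=> 1%R) h) => //.
- exact: ltW.
- move=> tau tau0; rewrite (integral_ball_cst muE vol_ball)//.
  by rewrite mul1r.
- exact: ltW.
- rewrite /g subKr.
  exact: powR_half_lt1.
move=> u; rewrite /h indicE; case: (boolP (u \in _)); last by rewrite mul0r; left.
rewrite inE /hball /= => ur; rewrite mul1r.
(* At the centre [powR] gives 0^(-g) = 0, so the first alternative applies. *)
have [->|u0] := eqVneq (dist v u) 0%R.
  by left; rewrite powR0// oppr_eq0 gt_eqF.
have {}u0 : (0 < dist v u)%R by rewrite lt_def u0 hnorm_ge0.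
have x1 : (1 <= rho / dist v u)%R by rewrite ler_pdivlMr// mul1r ltW.
right; have [j [jl ju]] := exp2_bracket x1.
have p2 : (0 < 2 ^+ j :> R)%R by rewrite exprn_gt0.
exists j; split => //; rewrite exprVn.
- move: ju; rewrite ltr_pdivrMr// exprS => ju.
  by rewrite ler_pdivrMr// ler_pdivrMr//; move: ju; nra.
- move: jl; rewrite ler_pdivlMr// => jl.
  by rewrite ltr_pdivlMr// mulrC (le_lt_trans jl)// ltr_pMl// ltr1n.
Qed.

(** Convertible with [Ialpha alpha] when k is [kern alpha]. *)
Definition fracint f u : R := hintS setT (fun v => k (hmul (hinv v) u) * f v)%R.

Let mk2 : measurable_fun setT (fun p : H * H => k (hmul (hinv p.2) p.1)).
Proof.
apply: (measurableT_comp mk); apply: measurable_hmul => //.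
exact: measurable_hinv.
Qed.

(** Holds at every u, convergent integral or not: the two parts in [hintS] are measurable in u by
    Tonelli, and so is [fine]. *)
Lemma measurable_fracint f : measurable_fun setT f -> measurable_fun setT (fracint f).
Proof.
move=> mf.
have mkf : measurable_fun setT (fun p : H * H => k (hmul (hinv p.2) p.1) * f p.2)%R.
  by apply: measurable_funM => //; exact: (measurableT_comp mf measurable_snd).
have part (h : R -> R) : measurable_fun setT h -> (forall x, 0 <= h x)%R ->
    measurable_fun setT (fun u => fine (hint (fun v =>
      (\1_setT v * h (k (hmul (hinv v) u) * f v))%:E))%R).
  move=> mh h0; apply: (measurableT_comp (fine_measurable measurableT)).
  pose G (p : H * H) := (h (k (hmul (hinv p.2) p.1) * f p.2)%R)%:E.
  have mG : measurable_fun setT G by apply/measurable_EFinP; exact: measurableT_comp.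
  have G0 p : 0 <= G p by rewrite lee_fin.
  rewrite (_ : (fun u => _) = (fun u => \int[mu]_v G (u, v))).
    exact: (@measurable_fun_fubini_tonelli_F _ _ _ _ _ mu G mG G0).
  apply/funext => u; rewrite muE.
  - by apply: eq_integral => v _; rewrite indicT mul1r.
  - apply/measurable_EFinP; apply: measurable_funM => //.
    by have /measurable_EFinP := measurableT_comp mG (pair1_measurable u).
  - by move=> v; rewrite lee_fin mulr_ge0.
apply: measurable_funB.
- apply: (part (fun x => Num.max x 0)%R) => [|x]; last by rewrite le_max lexx orbT.
  exact: measurable_maxr.
- apply: (part (fun x => Num.max (- x) 0)%R) => [|x]; last by rewrite le_max lexx orbT.
  by apply: measurable_maxr => //; exact: measurable_funN.
Qed.

(** The first summand is the near part, kernel radius 9r against data radius 8r. In the second,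
    2^delta comes from the diameter 2r, 2^(g + delta) from recentring the denominator at u0, the
    parenthesis from the tail beyond 8r, and c from the volume of the ball. *)
Definition osc_cst (s : R) : R :=
  (near_cst * 9 `^ alpha * 8 `^ s +
   C * 2 `^ delta * 2 `^ (g + delta) *
   (2 `^ (g + delta + s) / (1 - 2 `^ (s - (g + delta))) * 8 `^ (s - (g + delta))) * c)%R.

Lemma osc_cst_gt0 s : (s < g + delta)%R -> (0 < osc_cst s)%R.
Proof.
move=> sg; have h : (0 < 1 - 2 `^ (s - (g + delta)) :> R)%R.
  by rewrite subr_gt0 powR_gt1_lt1 ?ltr1n// subr_lt0.
rewrite /osc_cst; move: near_cst near_cst_gt0 => N N0.
by rewrite addr_gt0 ?mulr_gt0 ?powR_gt0 ?invr_gt0.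
Qed.

(* f is split at the ball of radius 8 r: near the centre the kernel is compared
   with its value at one reference point, far from it with the kernel based at a
   point u1 of the ball where the integral converges. *)
Lemma fracint_oscillation f (D s : R) (Z : set H) : measurable_fun setT f -> (0 <= D)%R ->
  (forall u r, (0 < r)%R -> \int[mu]_v (\1_(hball u r) v * `|f v|)%:E <= (D * r `^ s)%:E) ->
  (s < g + delta)%R -> measurable Z -> mu Z = 0 ->
  (forall u, ~ Z u -> \int[mu]_v `|k (hmul (hinv v) u) * f v|%:E < +oo) ->
  forall u0 r, (0 < r)%R -> exists a : R,
    \int[mu]_u (\1_(hball u0 r) u * `|fracint f u - a|)%:E <=
      (osc_cst s * D * r `^ (alpha + s))%:E.
Proof.
move=> mf D0 HD sg mZ Z0 Zfin u0 r r0.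
(* For u in B, a point v beyond 8r has |v^-1 u| >= 4r, so the diameter 2r of B is at most half of
   it; a point v within 8r has |v^-1 u| < 9r. *)
have r8 : (0 < 8 * r)%R by rewrite mulr_gt0.
have r9 : (0 < 9 * r)%R by rewrite mulr_gt0.
pose B := hball u0 r; pose B8 := hball u0 (8 * r).
have mB : measurable_fun setT (\1_B : H -> R) by exact: measurable_ball_indic.
have mB8 : measurable_fun setT (\1_B8 : H -> R) by exact: measurable_ball_indic.
have mC8 : measurable_fun setT (\1_(~` B8) : H -> R).
  by apply: measurable_indic; apply: measurableC; exact: measurable_hball.
have mnf : measurable_fun setT (fun v => `|f v|%R).
  exact: (measurableT_comp (@normr_measurable _ setT)).
have mku u : measurable_fun setT (fun v => k (hmul (hinv v) u)).
  apply: (measurableT_comp mk); apply: measurable_hmul => //; exact: measurable_hinv.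
have [u1 Bu1 Zu1] : exists2 u1, B u1 & ~ Z u1.
  apply: contrapT => H0.
  have : mu B <= mu Z.
    apply: le_measure; rewrite ?inE//; first exact: measurable_hball.
    by move=> u Bu; apply: contrapT => Zu; apply: H0; exists u.
  rewrite Z0 mu_ball// lee_fin leNgt => /negP; apply.
  by rewrite mulr_gt0// powR_gt0.
pose L := k (hvert (hone R n) ((2 * (9 * r)) ^+ 2)).
(* A comparison kernel independent of u, so that the integral of m f is a constant. It converges:
   near the centre f is integrable, and far from it u1 lies outside [Z]. *)
pose m v := (\1_B8 v * L + \1_(~` B8) v * k (hmul (hinv v) u1))%R.
have mm : measurable_fun setT m.
  by apply: measurable_funD; exact: measurable_funM.
have ikf u : ~ Z u -> mu.-integrable setT (fun v => (k (hmul (hinv v) u) * f v)%:E).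
  move=> Zu; apply/integrableP; split; last exact: Zfin.
  by apply/measurable_EFinP; exact: measurable_funM.
have imf : mu.-integrable setT (fun v => (m v * f v)%:E).
  apply/integrableP; split; first by apply/measurable_EFinP; exact: measurable_funM.
  apply: (@le_lt_trans _ _ (\int[mu]_v (`|L|%:E * (\1_B8 v * `|f v|)%:E +
      `|k (hmul (hinv v) u1) * f v|%:E))).
    apply: ge0_le_integral => //.
    - by apply/measurable_EFinP; apply: (measurableT_comp (@normr_measurable _ setT));
        exact: measurable_funM.
    - apply: emeasurable_funD.
        by apply: measurable_funeM; apply/measurable_EFinP; exact: measurable_funM.
      by apply/measurable_EFinP; apply: (measurableT_comp (@normr_measurable _ setT));
        exact: measurable_funM.
    move=> v _; rewrite -EFinM -EFinD lee_fin /m !indicE in_setC.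
    by case: (v \in B8); rewrite /= !(mul1r, mul0r, mulr0, addr0, add0r) normrM ?lerDl.
  have m1 : measurable_fun setT (fun v => (\1_B8 v * `|f v|)%:E).
    by apply/measurable_EFinP; exact: measurable_funM.
  rewrite ge0_integralD//; last 2 first.
  - exact: measurable_funeM.
  - by apply/measurable_EFinP; apply: (measurableT_comp (@normr_measurable _ setT));
      exact: measurable_funM.
  rewrite ge0_integralZl//.
  rewrite lte_add_pinfty ?Zfin//; apply: (@le_lt_trans _ _ (`|L| * (D * (8 * r) `^ s))%:E).
    by rewrite EFinM lee_wpmul2l ?lee_fin// HD.
  exact: ltry.
have [a aE] : exists a : R, a%:E = \int[mu]_v (m v * f v)%:E.
  exists (fine (\int[mu]_v (m v * f v)%:E)); rewrite fineK//.
  exact: integrable_fin_num.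
exists a.
pose G u := \int[mu]_v (\1_B8 v * `|k (hmul (hinv v) u) - L| * `|f v|)%:E.
pose J := (D * 2 `^ (g + delta + s) / (1 - 2 `^ (s - (g + delta))) *
  (8 * r) `^ (s - (g + delta)))%R.
pose E0 := (C * (2 * r) `^ delta * 2 `^ (g + delta) * J)%R.
have gd0 : (0 < g + delta)%R by rewrite addr_gt0.
have HJ : \int[mu]_v (\1_(~` B8) v * dist u0 v `^ (- (g + delta)) * `|f v|)%:E <= J%:E.
  by apply: far_integral => // [r' r'0|]; [exact: HD|exact: ltW].
have J0 : (0 <= J)%R.
  by rewrite -lee_fin; apply: le_trans HJ; apply: integral_ge0 => v _;
    rewrite lee_fin !mulr_ge0// powR_ge0.
have E00 : (0 <= E0)%R.
  by rewrite /E0; move: (J) J0 => x x0; rewrite !mulr_ge0 ?powR_ge0 ?(ltW C0).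
have mGv u : measurable_fun setT
    (fun v => (\1_B8 v * `|k (hmul (hinv v) u) - L| * `|f v|)%:E).
  apply/measurable_EFinP; apply: measurable_funM => //; apply: measurable_funM => //.
  by apply: (measurableT_comp (@normr_measurable _ setT)); exact: measurable_funB.
(* The far error is uniform in u; the near error [G] is controlled only after integrating in u. *)
have pt u : B u -> ~ Z u -> `|fracint f u - a|%:E <= G u + E0%:E.
  move=> Bu Zu.
  have Tu : (fracint f u)%:E = \int[mu]_v (k (hmul (hinv v) u) * f v)%:E.
    rewrite /fracint (hintS_integral muE)//.
    - by apply: eq_integral => v _; rewrite indicT mul1r.
    - exact: measurable_funM.
    - by under eq_integral do rewrite indicT mul1r; exact: Zfin.
  have -> : `|fracint f u - a|%:E = `| \int[mu]_v ((k (hmul (hinv v) u) - m v) * f v)%:E |.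
    rewrite -abse_EFin EFinB Tu aE -integralB_EFin ?ikf//; congr (`| _ |).
    by apply: eq_integral => v _; rewrite -EFinB mulrBl.
  apply: (le_trans (le_abse_integral _ measurableT _)).
    by apply/measurable_EFinP; apply: measurable_funM => //; exact: measurable_funB.
  pose h v := (\1_(~` B8) v * dist u0 v `^ (- (g + delta)) * `|f v|)%R.
  have mh : measurable_fun setT (fun v => (h v)%:E).
    apply/measurable_EFinP; apply: measurable_funM => //; apply: measurable_funM => //.
    by apply: (measurableT_comp (measurable_powR _)); exact: measurable_dist.
  have h0 v : 0 <= (h v)%:E by rewrite lee_fin !mulr_ge0// powR_ge0.
  pose K := (C * (2 * r) `^ delta * 2 `^ (g + delta))%R.
  have K0 : (0 <= K)%R by rewrite !mulr_ge0 ?powR_ge0 ?(ltW C0).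
  apply: (@le_trans _ _ (\int[mu]_v ((\1_B8 v * `|k (hmul (hinv v) u) - L| * `|f v|)%:E +
      K%:E * (h v)%:E))).
    apply: ge0_le_integral => //.
    - apply/measurable_EFinP; apply: (measurableT_comp (@normr_measurable _ setT)).
      by apply: measurable_funM => //; exact: measurable_funB.
    - by apply: emeasurable_funD => //; exact: measurable_funeM.
    move=> v _; rewrite abse_EFin -EFinM -EFinD lee_fin normrM /m /h !indicE in_setC.
    case: (boolP (v \in B8)) => [_|].
      by rewrite /= !(mul1r, mul0r, addr0, mulr0).
    rewrite notin_setE /B8 /hball /= => /negP; rewrite -leNgt => v8.
    rewrite !(mul1r, mul0r, add0r) mulrA ler_wpM2r//.
    have uu1 : (dist u1 u <= 2 * r)%R.
      rewrite (le_trans (hdist_triangle u1 u0 u))// mulr_natl mulr2n lerD//.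
        by rewrite hnormVC ltW.
      exact: ltW.
    (* Recentring at u0 costs a factor 2 and makes the tail integral the same for all u in B. *)
    have vu : (dist u0 v / 2 <= dist v u)%R.
      have := hdist_triangle u0 u v; rewrite (hnormVC u v).
      by move: Bu; rewrite /B /hball /=; lra.
    apply: (le_trans (k_reg _)).
      by apply: (le_trans uu1); rewrite ler_pdivlMr//; lra.
    have v0 : (0 < dist u0 v)%R by exact: lt_le_trans v8.
    rewrite -powRN -/g /K -!mulrA ler_wpM2l ?(ltW C0)//.
    rewrite ler_pM ?powR_ge0//.
      rewrite ge0_ler_powR ?nnegrE ?hnorm_ge0 ?(ltW delta0)//.
      by rewrite mulr_ge0 ?(ltW r0).
    have -> : (2 `^ (g + delta) * dist u0 v `^ (- (g + delta)) =
        (dist u0 v / 2) `^ (- (g + delta)))%R.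
      by rewrite (powRM _ (hnorm_ge0 _)) ?invr_ge0// (powR_invN _ (ler0n _ 2)) mulrC.
    by apply: powRN_le => //; [exact: ltW|rewrite divr_gt0].
  rewrite ge0_integralD//; [|by move=> v _; rewrite mule_ge0|exact: measurable_funeM].
  rewrite leeD2l// ge0_integralZl//.
  have -> : E0%:E = K%:E * J%:E by rewrite -EFinM.
  by rewrite lee_wpmul2l.
have G0 u : 0 <= G u by apply: integral_ge0 => v _; rewrite lee_fin !mulr_ge0.
pose F (p : H * H) := (\1_B p.1 * (\1_B8 p.2 * `|k (hmul (hinv p.2) p.1) - L| * `|f p.2|))%:E.
have mF : measurable_fun setT F.
  apply/measurable_EFinP; apply: measurable_funM.
    exact: (measurableT_comp mB measurable_fst).
  apply: measurable_funM; last exact: (measurableT_comp mnf measurable_snd).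
  apply: measurable_funM; first exact: (measurableT_comp mB8 measurable_snd).
  by apply: (measurableT_comp (@normr_measurable _ setT)); exact: measurable_funB.
have F0 p : 0 <= F p by rewrite lee_fin !mulr_ge0.
have BG u : (\1_B u)%:E * G u = \int[mu]_v F (u, v).
  by rewrite -ge0_integralZl.
have mBG : measurable_fun setT (fun u => (\1_B u)%:E * G u).
  under eq_fun do rewrite BG.
  exact: (@measurable_fun_fubini_tonelli_F _ _ _ _ _ mu F).
apply: (@le_trans _ _ (\int[mu]_u ((\1_B u)%:E * G u + (\1_B u * E0)%:E))).
  apply: ae_ge0_le_integral => //.
  - apply/measurable_EFinP; apply: measurable_funM => //.
    apply: (measurableT_comp (@normr_measurable _ setT)); apply: measurable_funB => //.
    exact: measurable_fracint.
  - by move=> u _; rewrite adde_ge0 ?mule_ge0// lee_fin mulr_ge0.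
  - by apply: emeasurable_funD => //; apply/measurable_EFinP; exact: measurable_funM.
  exists Z; split => // u /=; apply: contra_notP => Zu _.
  rewrite indicE; case: (boolP (u \in B)) => [uB|_]; last by rewrite !mul0r mul0e add0e.
  by rewrite !mul1r mul1e pt//; move: uB; rewrite inE.
rewrite ge0_integralD//; last 3 first.
- by move=> u _; rewrite mule_ge0.
- by move=> u _; rewrite lee_fin mulr_ge0.
- by apply/measurable_EFinP; exact: measurable_funM.
rewrite (integral_ball_cst muE vol_ball)//.
have near_part : \int[mu]_u ((\1_B u)%:E * G u) <=
    (near_cst * (9 * r) `^ alpha * (D * (8 * r) `^ s))%:E.
  under eq_integral do rewrite BG.
  (* With u integrated first, each v in [B8] sees only the kernel on the ball of radius 9r around
     v. *)
  rewrite (fubini_tonelli F)//.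
  apply: (@le_trans _ _ (\int[mu]_v ((near_cst * (9 * r) `^ alpha)%:E *
      (\1_B8 v * `|f v|)%:E))); last first.
    have Kn0 : 0 <= (near_cst * (9 * r) `^ alpha)%:E.
      by rewrite lee_fin; apply: mulr_ge0; [exact/ltW/near_cst_gt0|exact: powR_ge0].
    have m1 : measurable_fun setT (fun v => (\1_B8 v * `|f v|)%:E).
      by apply/measurable_EFinP; exact: measurable_funM.
    by rewrite ge0_integralZl// [leRHS]EFinM lee_wpmul2l// HD.
  apply: ge0_le_integral => //.
  - by move=> v _; exact: integral_ge0.
  - exact: (@measurable_fun_fubini_tonelli_G _ _ _ _ _ mu F).
  - by apply: measurable_funeM; apply/measurable_EFinP; exact: measurable_funM.
  move=> v _.
  have mq : measurable_fun setT (fun u => (\1_(hball v (9 * r)) u * `|k (hmul (hinv v) u) - L|)%:E).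
    apply/measurable_EFinP; apply: measurable_funM; first exact: measurable_ball_indic.
    apply: (measurableT_comp (@normr_measurable _ setT)); apply: measurable_funB => //.
    by apply: (measurableT_comp mk); exact: measurable_hmul.
  apply: (@le_trans _ _ (\int[mu]_u ((\1_B8 v * `|f v|)%:E *
      (\1_(hball v (9 * r)) u * `|k (hmul (hinv v) u) - L|)%:E))).
    apply: ge0_le_integral => //.
    - exact: (measurableT_comp mF (pair2_measurable v)).
    - exact: measurable_funeM.
    move=> u _; rewrite -EFinM lee_fin /= !indicE.
    case: (boolP (v \in B8)); last by rewrite !mul0r mulr0.
    rewrite inE /B8 /hball /= => v8.
    case: (boolP (u \in B)); last by rewrite mul0r !mulr_ge0.
    rewrite inE /B /hball /= => ur.
    rewrite mem_set; first by rewrite !mul1r mulrC.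
    rewrite /hball /=; have := hdist_triangle v u0 u; rewrite (hnormVC v u0).
    by move: v8 ur; lra.
  rewrite ge0_integralZl//.
  rewrite muleC lee_wpmul2r ?lee_fin ?mulr_ge0//.
  exact: near_integral.
rewrite -/B; apply: (le_trans (leeD near_part (lexx _))).
rewrite -EFinD lee_fin le_eqVlt; apply/orP; left; apply/eqP.
rewrite /E0 /J /osc_cst !powRM ?(ltW r0)//.
(* Since Q - g = alpha, both parts scale as r^(alpha + s). *)
have er : (r `^ alpha * r `^ s = r `^ (alpha + s))%R.
  by rewrite powRD ?(gt_eqF r0) ?implybT.
have er2 : (r `^ delta * r `^ (s - (g + delta)) * r `^ Q = r `^ (alpha + s))%R.
  rewrite -!powRD ?(gt_eqF r0) ?implybT//; congr (_ `^ _)%R; rewrite /g; ring.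
rewrite mulrDl mulrDl; congr (_ + _)%R.
  by rewrite -er; ring.
by rewrite -er2; ring.
Qed.

End Kernel.
End FractionalIntegral.

(** * Choice of exponents and constants *)

Unset Implicit Arguments.
Set Strict Implicit.
Set Printing Implicit Defensive.

Theorem theorem4p6 (R : realType) (n : nat) (alpha p kappa beta delta : R) :
  (0 < n)%N ->
  0 < alpha -> alpha < hQ R n ->
  1 <= p -> p < hQ R n / alpha ->
  1 - (alpha * p) / hQ R n <= kappa -> kappa < 1 ->
  beta / hQ R n = alpha / hQ R n - (1 - kappa) / p ->
  0 < delta -> delta <= 1 ->
  (exists C : R, 0 < C /\
     forall u v w : Hn R n,
       hnorm (hmul (hinv v) u) <= hnorm (hmul (hinv w) u) / 2 ->
       `|Kalpha alpha u w - Kalpha alpha v w|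
         <= C * hnorm (hmul (hinv v) u) `^ delta
              / hnorm (hmul (hinv w) u) `^ (hQ R n - alpha + delta)) ->
  beta < delta ->
  exists C : R, 0 < C /\
    forall f : Hn R n -> R,
      in_morrey p kappa f ->
      (* I_alpha f is given a.e. by an absolutely convergent integral *)
      (exists N : set (Hn R n), measurable N /\ hvol N = 0%E /\
         forall u, ~ N u ->
           (hint (fun v => `|Kalpha alpha u v * f v|%:E) < +oo)%E) ->
      in_campanato beta (Ialpha alpha f) /\
      (campanato_norm beta (Ialpha alpha f) <= C%:E * morrey_norm p kappa f)%E.
Proof.
move=> _ alpha0 alphaQ p1 _ _ _ betaE delta0 _ [C [C0 reg]] beta_delta.
have p0 : 0 < p by exact: lt_le_trans p1.
have Q0 : 0 < hQ R n by rewrite /hQ ltr0n addn2.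
have [mu muE] := hint_measure R n.
have [c c0 vol_ball] : exists2 c : R, 0 < c &
    forall u r, 0 < r -> hvol (hball u r : set (Hn R n)) = (c * r `^ hQ R n)%:E.
  have [c c0 vol] := hvol_ball R n; exists c => // u r r0.
  by rewrite vol// /hQ powR_mulrn// ltW.
have g0 : 0 < hQ R n - alpha by rewrite subr_gt0.
(* Placing the pole w at the identity yields the estimate for the convolution kernel alone. *)
have k_reg (u v : Hn R n) : hnorm (hmul (hinv v) u) <= hnorm u / 2 ->
    `|kern alpha u - kern alpha v| <=
    C * hnorm (hmul (hinv v) u) `^ delta / hnorm u `^ (hQ R n - alpha + delta).
  by have := reg u v (hone R n); rewrite !KalphaE hinv1 !hmul1h.
have [A A0 k_size] := kernel_size C0 delta0 g0 k_reg (@kern_even R n alpha).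
have mk := @measurable_kern R n alpha.
(* The integral of |f| over B grows like |B|^e, that is r^s with s = Q e; then s - (Q - alpha +
   delta) = beta - delta. *)
pose s := hQ R n + beta - alpha; pose e := 1 - (1 - kappa) / p.
have Qe : hQ R n * e = s.
  have -> : e = 1 + (beta / hQ R n - alpha / hQ R n) by rewrite /e betaE; ring.
  by rewrite /s; field; rewrite gt_eqF.
have sg : s < hQ R n - alpha + delta by rewrite /s; lra.
pose K := osc_cst n c alpha delta A C s.
have K0 : 0 < K by exact: osc_cst_gt0.
(* The outer 2 replaces a constant by the mean, 2 c^e comes from the Morrey bound on balls, and the
   last power from the Campanato normalization. *)
pose C1 := 2 * (K * (2 * c `^ e)) * c `^ (- 1 - beta / hQ R n).
have C10 : 0 < C1.
  by rewrite /C1; move: (K) K0 => x x0; rewrite !mulr_gt0 ?powR_gt0.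
exists C1; split=> // f [mf fM] [Z [mZ [Z0 Zfin]]].
have mT : measurable_fun setT (Ialpha alpha f) := measurable_fracint muE mk mf.
have mub : mu Z = 0%E by rewrite -Z0 (hvolE muE).
(* M is any positive bound for the Morrey norm, because the norm itself may vanish. *)
have osc (M : R) (u : Hn R n) (r : R) : 0 < M -> 0 < r -> (morrey_norm p kappa f <= M%:E)%E ->
    (\int[mu]_v (\1_(hball u r) v * `|Ialpha alpha f v|)%:E < +oo)%E /\
    (\int[mu]_v (\1_(hball u r) v *
      `|Ialpha alpha f v - havg (hball u r) (Ialpha alpha f)|)%:E <=
      (2 * (K * (2 * M * c `^ e) * r `^ (alpha + s)))%:E)%E.
  move=> M0 r0 fM'.
  have D0 : 0 <= 2 * M * c `^ e by rewrite !mulr_ge0 ?powR_ge0 ?(ltW M0).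
  have HD (u' : Hn R n) (r' : R) : 0 < r' -> (\int[mu]_v (\1_(hball u' r') v * `|f v|)%:E <=
      (2 * M * c `^ e * r' `^ s)%:E)%E.
    move=> r'0; have := morrey_ball muE c0 vol_ball u' p1 M0 r'0 mf fM'.
    by rewrite -/e (powRM _ (ltW c0)) ?powR_ge0// -powRrM Qe mulrA.
  have Zf (u' : Hn R n) : ~ Z u' ->
      (\int[mu]_v `|kern alpha (hmul (hinv v) u') * f v|%:E < +oo)%E.
    have mku : measurable_fun setT (fun v : Hn R n => kern alpha (hmul (hinv v) u')).
      by apply: (measurableT_comp mk); apply: measurable_hmul => //; exact: measurable_hinv.
    have mkf := measurableT_comp (@normr_measurable R setT) (measurable_funM mku mf).
    move=> Zu; have Zu' : (hint (fun v => `|kern alpha (hmul (hinv v) u') * f v|%:E) < +oo)%E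
      := Zfin u' Zu.
    by rewrite -muE//; exact/measurable_EFinP.
  have [a aW] := fracint_oscillation muE c0 vol_ball alpha0 alphaQ delta0 A0 C0 mk
    k_size (fun u v w => reg u v w) mf D0 HD sg mZ mub Zf u r0.
  exact: (oscillation_le muE c0 vol_ball r0 mT aW).
have quot (M : R) (u : Hn R n) (r : R) : 0 < M -> 0 < r -> (morrey_norm p kappa f <= M%:E)%E ->
    (campanato_quot beta (Ialpha alpha f) u r <= (C1 * M)%:E)%E.
  move=> M0 r0 fM'; have [_ oM] := osc M u r M0 r0 fM'.
  rewrite /campanato_quot muE; last 2 first.
  - apply/measurable_EFinP; apply: measurable_funM; first exact: measurable_ball_indic.
    by apply: (measurableT_comp (@normr_measurable _ setT)); exact: measurable_funB.
  - by move=> v; rewrite lee_fin mulr_ge0.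
  rewrite vol_ball//=.
  apply: (le_trans (lee_wpmul2l _ oM)); first by rewrite lee_fin powR_ge0.
  rewrite -EFinM lee_fin le_eqVlt; apply/orP; left; apply/eqP.
  rewrite (powRM _ (ltW c0)) ?powR_ge0// -powRrM /C1.
  (* alpha + s = Q + beta, so the powers of r cancel against the normalization. *)
  have -> : alpha + s = - (hQ R n * (- 1 - beta / hQ R n)).
    by rewrite /s; field; rewrite gt_eqF.
  rewrite powRN; move: (K) => x; field.
  by rewrite gt_eqF// powR_gt0.
have [m m0 mE] : exists2 m : R, 0 <= m & morrey_norm p kappa f = m%:E.
  have n0 : (0 <= morrey_norm p kappa f)%E.
    apply: (@le_trans _ _ (morrey_quot p kappa f (hone R n) 1)); first exact: poweR_ge0.
    by apply: ereal_sup_ubound; exists (hone R n), 1.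
  exists (fine (morrey_norm p kappa f)); first exact: fine_ge0.
  by rewrite fineK// ge0_fin_numE.
have norm_le : (campanato_norm beta (Ialpha alpha f) <= C1%:E * morrey_norm p kappa f)%E.
  (* The slack eps allows the positive bound M = m + eps / C1 even when m = 0. *)
  rewrite mE -EFinM; apply/lee_addgt0Pr => eps eps0; rewrite -EFinD.
  have -> : C1 * m + eps = C1 * (m + eps / C1) by field; rewrite gt_eqF.
  apply: ub_ereal_sup => _ [u [r [r0 ->]]]; apply: quot => //.
    by rewrite ltr_wpDl// divr_gt0.
  by rewrite mE lee_fin lerDl divr_ge0 ?ltW.
split=> //; split; last by apply: le_lt_trans norm_le _; rewrite mE -EFinM ltry.
split=> // u r r0; rewrite muE.
- have m1 : 0 < m + 1 by rewrite ltr_wpDl.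
  by have [] := osc (m + 1) u r m1 r0 _; rewrite ?mE ?lee_fin ?lerDl.
- apply/measurable_EFinP; apply: measurable_funM; first exact: measurable_ball_indic.
  exact: (measurableT_comp (@normr_measurable _ setT)).
- by move=> v; rewrite lee_fin mulr_ge0.
Qed.
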